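(* Let $(S(t))_{t\ge 0}$ be a simple symmetric random walk on $\mathbb{Z}$ with $S(0)=0$. For $t\ge 1$ let $L(t,x)=\#\{0<s\le t: S(s)=x\}$ be its local time at $x\in\mathbb{Z}$ and let $\mathcal{K}(t)=\{y\in\mathbb{Z}: L(t,y)=\max_{z\in\mathbb{Z}}L(t,z)\}$ be the set of favourite sites at time $t$. Let $$f(4):=\#\{t\ge 1:\ S(t)\in\mathcal{K}(t)\ \text{and}\ \#\mathcal{K}(t)=4\}\in\{0,1,2,\dots\}\cup\{\infty\}.$$ Then $\mathbf{E}\big(f(4)\big)<\infty$.
   Context: A simple symmetric random walk on $\mathbb{Z}$ has i.i.d. increments equal to $+1$ or $-1$ with probability $1/2$ each. Note that the local time $L(t,x)$ counts times $0<s\le t$, so time $0$ is not counted. *)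

(* Defs.v *)
From HB Require Import structures.
From mathcomp Require Import all_boot all_order all_algebra finmap.
From mathcomp Require Import all_classical all_reals all_analysis.

Set Implicit Arguments.
Unset Strict Implicit.
Unset Printing Implicit Defensive.

Import Order.TTheory GRing.Theory Num.Theory.

Local Open Scope classical_set_scope.
Local Open Scope ring_scope.

HB.instance Definition _ := isPointed.Build int 0.
HB.instance Definition _ := @isMeasurable.Build default_measure_display
  int discrete_measurable discrete_measurable0
  discrete_measurableC discrete_measurableU.

Section walk.
Context (R : realType) (d : measure_display) (T : measurableType d).
Implicit Type P : probability T R.

Definition mutually_independent P (I : choiceType) d'
    (E : measurableType d') (X : I -> T -> E) : Prop :=
  forall (J : {fset I}) (A : I -> set E),
    (forall i, i \in J -> measurable (A i)) ->
    P (\bigcap_(i in [set` J]) (X i @^-1` A i)) =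
    (\prod_(i <- J) P (X i @^-1` A i))%E.

Definition increment (S : nat -> T -> int) (t : nat) (w : T) : int :=
  S t.+1 w - S t w.

(* The starting point is left free. *)
Record simple_symmetric_walk P (S : nat -> {RV P >-> int}) : Prop := {
  increment_up :
    forall t, P [set w | increment S t w = 1] = (2^-1)%:E;
  increment_down :
    forall t, P [set w | increment S t w = -1] = (2^-1)%:E;
  increment_independent : mutually_independent P (increment S)
}.

End walk.

Section favourite_sites.
Context (T : Type).
Implicit Type S : nat -> T -> int.

Definition local_time S (w : T) (t : nat) (x : int) : nat :=
  #|[set s : 'I_t.+1 | (0 < s)%N && (S s w == x)]%SET|.

Definition favourite_sites S (w : T) (t : nat) : set int :=
  [set y | forall z, (local_time S w t z <= local_time S w t y)%N].

Definition favourite_times S (r : nat) (w : T) : set nat :=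
  [set t | [/\ (1 <= t)%N, favourite_sites S w t (S t w) &
               (favourite_sites S w t #= `I_r)%card]].

(* [counting] takes the value [+oo] on infinite sets. *)
Definition favourite_count (R : realType) S (r : nat) (w : T) : \bar R :=
  counting (favourite_times S r w).

End favourite_sites.

(* Main.v *)
Require Import Defs.
From mathcomp Require Import all_boot all_order all_algebra.
From mathcomp Require Import all_classical all_reals all_analysis.
From mathcomp Require Import measurable_realfun finmap zify ring lra.

Import Order.TTheory GRing.Theory Num.Theory.

Local Open Scope classical_set_scope.
Local Open Scope ring_scope.

(* Writing the number of favourite times as a sum over t, its mean is the sum of
   2^-|p| over the finite +-1 paths p whose endpoint x is one of exactly four
   favourite sites.  Fix the level h, the maximal local time.  A path is
   determined by the stacks of its successive steps out of each site, and the
   stacks obey a Ray-Knight description: going away from x on the side not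
   containing 0, the number of crossings is a critical branching process with
   geometric offspring; on the other side it has one immigrant per generation
   up to 0 and none afterwards.  The local time of a site is the length of its
   stack.

   Reading the stacks one coin flip at a time turns the branching process into a
   simple random walk cut into blocks, and everything follows from optional
   stopping.  Put e = h^(-9/20).  Each further site with local time exactly h
   costs a factor e: the probability of a block of length exactly h is at most e
   times the probability of a longer block, which would be fatal.  After such a
   block the process is near h/2, and surviving below h from there until
   extinction costs another factor e, while with immigration the mean number of
   generations survived is of order e h.  Summing over x, three further
   favourite sites at level h have weight O(e^5 h) = O(h^(-5/4)), which is
   summable in h. *)

(** * Coin flips at a single site: recursions and optional stopping *)

Section block.
Context {R : realType}.
Implicit Types (F : nat -> nat -> R) (m j r k : nat).

(* State of a site during the exploration: [j] left steps must still be taken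
   from it, [r] right steps have been taken, [m] more steps are allowed.  The
   mean runs over fair coin flips up to the last left step; blocks that would
   need more than [m] steps contribute 0. *)
Fixpoint block F m j r : R :=
  match j, m with
  | 0%N, _ => F m r
  | _.+1, 0%N => 0
  | j'.+1, m'.+1 => (block F m' j' r + block F m' j r.+1) / 2
  end.

(* The part missing from [block]: [F] is evaluated when the allowance runs out. *)
Fixpoint overflow F m j r : R :=
  match j, m with
  | 0%N, _ => 0
  | _.+1, 0%N => F j r
  | j'.+1, m'.+1 => (overflow F m' j' r + overflow F m' j r.+1) / 2
  end.

Fixpoint exceed m j : R :=
  match j, m with
  | 0%N, _ => 0
  | _.+1, 0%N => 1
  | j'.+1, m'.+1 => (exceed m' j' + exceed m' j) / 2
  end.

(* The last left step uses up the allowance exactly. *)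
Fixpoint hit m j : R :=
  match j, m with
  | 0%N, _ => (m == 0)%:R
  | _.+1, 0%N => 0
  | j'.+1, m'.+1 => (hit m' j' + hit m' j) / 2
  end.

Lemma block_le F F' m j r :
  (forall m' r', (m' + r' + j = m + r)%N -> F m' r' <= F' m' r') ->
  block F m j r <= block F' m j r.
Proof.
elim: m j r => [|m IH] [|j] r FF' /=; try by apply: FF'; rewrite addn0.
  by [].
have h1 : block F m j r <= block F' m j r
  by apply: IH => m' r' E; apply: FF'; lia.
have h2 : block F m j.+1 r.+1 <= block F' m j.+1 r.+1
  by apply: IH => m' r' E; apply: FF'; lia.
lra.
Qed.

Lemma block_eq F F' m j r :
  (forall m' r', (m' + r' + j = m + r)%N -> F m' r' = F' m' r') ->
  block F m j r = block F' m j r.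
Proof.
by move=> FF'; apply/eqP; rewrite eq_le !block_le // => m' r' /FF' E; rewrite E.
Qed.

Lemma block0 m j r : block (fun _ _ => 0) m j r = 0.
Proof. by elim: m j r => [|m IH] [|j] r //=; rewrite !IH; lra. Qed.

Lemma block_ge0 F m j r :
  (forall m' r', (m' + r' + j = m + r)%N -> 0 <= F m' r') -> 0 <= block F m j r.
Proof. by move=> F0; rewrite -(block0 m j r); exact: block_le. Qed.

Lemma blockD F F' m j r :
  block (fun m r => F m r + F' m r) m j r = block F m j r + block F' m j r.
Proof. by elim: m j r => [|m IH] [|j] r //=; rewrite ?IH; lra. Qed.

Lemma blockZ (c : R) F m j r :
  block (fun m r => c * F m r) m j r = c * block F m j r.
Proof. by elim: m j r => [|m IH] [|j] r //=; rewrite ?IH; lra. Qed.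

Lemma block_sum (I : Type) (s : seq I) (F : I -> nat -> nat -> R) m j r :
  block (fun m r => \sum_(i <- s) F i m r) m j r = \sum_(i <- s) block (F i) m j r.
Proof.
elim: s => [|i s IH].
  rewrite big_nil; apply: etrans (block0 m j r); apply: block_eq => m' r' _.
  by rewrite big_nil.
by rewrite big_cons -IH -blockD; apply: block_eq => m' r' _; rewrite big_cons.
Qed.

(** Optional stopping for a supermartingale [Phi] of the state and the remaining allowance, by
    induction on the allowance. *)
Lemma block_overflow_le F G (Phi : nat -> nat -> nat -> R) :
  (forall m r, F m r <= Phi m 0%N r) ->
  (forall m r, 0 <= Phi m 0%N r) ->
  (forall j r, G j.+1 r <= Phi 0%N j.+1 r) ->
  (forall m j r,
     (Phi m j r + Phi m j.+1 r.+1) / 2 <= Phi m.+1 j.+1 r) ->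
  forall m j r, block F m j r + overflow G m j r <= Phi m j r.
Proof.
move=> hF h0 hG hP; elim=> [|m IH] [|j] r /=; rewrite ?addr0 ?add0r //.
apply: le_trans (hP m j r); have := IH j r; have := IH j.+1 r.+1; lra.
Qed.

Lemma block_overflow_harmonic (phi : nat -> nat -> R) m j r :
  (forall j r, phi j.+1 r = (phi j r + phi j.+1 r.+1) / 2) ->
  block (fun _ r => phi 0%N r) m j r + overflow phi m j r = phi j r.
Proof.
move=> h; elim: m j r => [|m IH] [|j] r /=; rewrite ?addr0 ?add0r //.
by rewrite (h j r) -(IH j r) -(IH j.+1 r.+1); lra.
Qed.

Lemma overflow1 m j r : overflow (fun _ _ => 1) m j r = exceed m j.
Proof. by elim: m j r => [|m IH] [|j] r //=; rewrite !IH. Qed.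

Lemma overflowD F F' m j r :
  overflow (fun m r => F m r + F' m r) m j r = overflow F m j r + overflow F' m j r.
Proof. by elim: m j r => [|m IH] [|j] r //=; rewrite ?IH; lra. Qed.

Lemma overflowZ (c : R) F m j r :
  overflow (fun m r => c * F m r) m j r = c * overflow F m j r.
Proof. by elim: m j r => [|m IH] [|j] r //=; rewrite ?IH; lra. Qed.

Lemma overflow_le F F' m j r :
  (forall j' r', F j' r' <= F' j' r') -> overflow F m j r <= overflow F' m j r.
Proof.
move=> FF'; elim: m j r => [|m IH] [|j] r //=.
by have := IH j r; have := IH j.+1 r.+1; lra.
Qed.

Lemma overflow_ge0 F m j r :
  (forall j' r', 0 <= F j' r') -> 0 <= overflow F m j r.
Proof.
move=> F0; elim: m j r => [|m IH] [|j] r //=.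
by have := IH j r; have := IH j.+1 r.+1; lra.
Qed.

Lemma block1 m j r : block (fun _ _ => 1) m j r = 1 - exceed m j.
Proof.
have h (_ _ : nat) : 1 = (1 + 1) / 2 :> R by lra.
apply: (canRL (addrK _)); rewrite -(overflow1 m j r).
exact: (@block_overflow_harmonic (fun _ _ => 1) m j r h).
Qed.

Lemma exceed_ge0 m j : 0 <= exceed m j.
Proof. by rewrite -(overflow1 m j 0); apply: overflow_ge0. Qed.

Lemma exceed_le1 m j : exceed m j <= 1.
Proof.
have : 0 <= block (fun _ _ => 1) m j 0 by apply: block_ge0.
by rewrite block1; lra.
Qed.

Lemma block_hit (g : nat -> R) m j r :
  block (fun m r => if m is 0%N then g r else 0) m j r = hit m j * g (m + r - j)%N.
Proof.
elim: m j r => [|m IH] [|j] r /=; rewrite ?mul1r ?mul0r ?subn0 //.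
by rewrite !IH addnS addSn !subSS; field.
Qed.

Lemma hit_ge0 m j : 0 <= hit m j.
Proof.
rewrite -(mulr1 (hit m j)) -(@block_hit (fun _ => 1) m j 0).
by apply: block_ge0 => -[|m'] r'.
Qed.

Lemma hit_le_block1 m j : hit m j <= 1 - exceed m j.
Proof.
rewrite -(mulr1 (hit m j)) -(@block_hit (fun _ => 1) m j 0) -(block1 m j 0).
by apply: block_le => -[|m'] r'.
Qed.

(** Both sides are the probability of exactly [j] left steps in [m] flips. For [m > 0], a last flip
    to the left gives [hit m j]; a last flip to the right, turned over, gives [hit m j.+1]. *)
Lemma exceed_diff m j : exceed m j.+1 - exceed m j = hit m j + hit m j.+1.
Proof.
elim: m j => [|m IH] [|j] /=; try lra.
  by have := IH 0%N; case: (m) => /=; rewrite ?eqxx /= => *; lra.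
by have := IH j; have := IH j.+1; rewrite /=; lra.
Qed.

(* Optional stopping at the cap [m]: the martingale here is (rights - lefts). *)
Lemma overflow_martingale m j r :
  overflow (fun j r => (j + r)%:R) m j r = (j + r)%:R * exceed m j + m%:R * hit m j.
Proof.
elim: m j r => [|m IH] [|j] r /=; rewrite ?(mulr0, mul0r, addr0, mulr1) //.
rewrite !IH; have := exceed_diff m j => E.
rewrite !addSn !addnS -!(natr1 (_ + _)) -(natr1 m).
have -> : hit m j.+1 = exceed m j.+1 - exceed m j - hit m j by lra.
by field.
Qed.

End block.

(** * Exponential bounds for the flips *)

Section tails.
Context {R : realType} (e : R) (e0 : 0 < e).
Implicit Types (m j r k : nat).

(** The hyperbolic cosine, which is the exponential moment of one flip; [tail_base] is the Chernoff
    factor per flip for a deviation of [e] per flip. *)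
Definition ch : R := (expR e + expR (- e)) / 2.
Definition tail_base : R := ch * expR (- e ^+ 2).

Lemma ch_ge1 : 1 <= ch.
Proof.
by rewrite /ch; have := expR_ge1Dx e; have := expR_ge1Dx (- e); lra.
Qed.

Lemma ch_gt0 : 0 < ch. Proof. exact: lt_le_trans ltr01 ch_ge1. Qed.

Lemma tail_baseX m : tail_base ^+ m = ch ^+ m * expR (- (e ^+ 2 * m%:R)).
Proof. by rewrite /tail_base exprMn -expRM_natr mulNr. Qed.

Lemma tail_baseX_ge0 m : 0 <= tail_base ^+ m.
Proof. by rewrite tail_baseX mulr_ge0 ?exprn_ge0 ?expR_ge0// ltW// ch_gt0. Qed.

(** Each flip moves [j + r] by plus or minus one, so the right-hand side is a martingale in the
    remaining allowance [m]; stopping early only leaves a factor [ch ^+ m], which is at least 1. *)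
Lemma block_overflow_expR m j r :
  block (fun _ r => expR (e * r%:R)) m j r
  + overflow (fun j r => expR (e * (j + r)%:R)) m j r
  <= ch ^+ m * expR (e * (j + r)%:R).
Proof.
apply: (@block_overflow_le R _ _ (fun m j r => ch ^+ m * expR (e * (j + r)%:R))) => //.
- move=> m' r'; rewrite add0n ler_peMl ?expR_ge0//.
  by apply: exprn_ege1; exact: ch_ge1.
- by move=> m' r'; rewrite mulr_ge0 ?expR_ge0// exprn_ge0// ltW// ch_gt0.
- by move=> j' r'; rewrite expr0 mul1r.
- move=> m' j' r'; rewrite exprS -mulrDr /ch.
  have -> : expR (e * (j' + r')%:R) = expR (- e) * expR (e * (j'.+1 + r')%:R).
    by rewrite -expRD; congr expR; rewrite addSn -natr1; ring.
  have -> : expR (e * (j'.+1 + r'.+1)%:R) = expR e * expR (e * (j'.+1 + r')%:R).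
    by rewrite -expRD; congr expR; rewrite addnS -natr1; ring.
  by rewrite le_eqVlt; apply/orP; left; apply/eqP; field.
Qed.

Lemma block_expR m j r :
  block (fun _ r => expR (e * r%:R)) m j r <= ch ^+ m * expR (e * (j + r)%:R).
Proof.
apply: le_trans (block_overflow_expR m j r); rewrite lerDl.
by apply: overflow_ge0 => *; exact: expR_ge0.
Qed.

Lemma overflow_expR m j r :
  overflow (fun j r => expR (e * (j + r)%:R)) m j r
  <= ch ^+ m * expR (e * (j + r)%:R).
Proof.
apply: le_trans (block_overflow_expR m j r); rewrite lerDr.
by apply: block_ge0 => *; exact: expR_ge0.
Qed.

Lemma ler_expR_div (x : R) : x <= e^-1 * expR (e * x).
Proof.
rewrite -(ler_pM2l e0) mulrA divff ?gt_eqF// mul1r.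
by have := expR_ge1Dx (e * x); lra.
Qed.

(* By optional stopping, the left-hand side is the mean of (rights - lefts) on
   the overflow event, and this difference is rarely larger than [e * m]. *)
Lemma overflow_drift m k :
  m%:R * hit m k <= e * m%:R * exceed m k + e^-1 * tail_base ^+ m.
Proof.
have E : m%:R * hit m k =
    overflow (fun j r => (j + r)%:R + - k%:R * 1) m k 0 :> R.
  rewrite (overflowD (fun j r => (j + r)%:R) (fun _ _ => - k%:R * 1)).
  by rewrite (overflowZ _ (fun _ _ => 1)) overflow1 overflow_martingale addn0; ring.
rewrite E; apply: (@le_trans _ _ (overflow (fun j r => e * m%:R * 1 +
  (e^-1 * expR (- (e * k%:R) - e ^+ 2 * m%:R)) * expR (e * (j + r)%:R)) m k 0)).
  apply: overflow_le => j r; have := ler_expR_div ((j + r)%:R - k%:R - e * m%:R).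
  rewrite -[X in _ <= _ + X]mulrA -expRD.
  have -> : - (e * k%:R) - e ^+ 2 * m%:R + e * (j + r)%:R =
    e * ((j + r)%:R - k%:R - e * m%:R) by ring.
  lra.
rewrite (overflowD (fun _ _ => _ * 1) (fun j r => _ * expR (e * (j + r)%:R))).
rewrite (overflowZ _ (fun _ _ => 1)) (overflowZ _ (fun j r => expR (e * (j + r)%:R))).
rewrite overflow1 lerD2l.
apply: (@le_trans _ _ (e^-1 * expR (- (e * k%:R) - e ^+ 2 * m%:R) *
    (ch ^+ m * expR (e * k%:R)))).
  rewrite ler_wpM2l ?mulr_ge0 ?expR_ge0 ?invr_ge0 ?(ltW e0)//.
  by have := overflow_expR m k 0; rewrite addn0.
rewrite -!mulrA ler_wpM2l ?invr_ge0 ?(ltW e0)// tail_baseX.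
rewrite mulrCA -expRD.
have -> : - (e * k%:R) - e * (e * m%:R) + e * k%:R = - (e ^+ 2 * m%:R) by ring.
exact: lexx.
Qed.

(** Chernoff bound for completing [k] left steps too fast: [m - 2 * j] moves by plus or minus one at
    each flip and is nonnegative once [j = 0]. *)
Lemma block1_le m k : m%:R * (1 + e) <= 2 * k%:R -> 1 - exceed m k <= tail_base ^+ m.
Proof.
move=> hk; rewrite -(block1 m k 0) -[leLHS]addr0.
apply: (@le_trans _ _ (ch ^+ m * expR (e * (m%:R - 2 * k%:R)))).
  have -> : 0 = overflow (fun _ _ => 0 : R) m k 0.
    by elim: m k {hk} 0%N => [|m IH] [|k] r //=; rewrite -!IH; lra.
  apply: (@block_overflow_le R _ _
    (fun m j r => ch ^+ m * expR (e * (m%:R - 2 * j%:R)))).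
  - move=> m' _; rewrite mulr0 subr0 mulr_ege1 ?exprn_ege1 ?ch_ge1//.
    by rewrite -expR0 ler_expR mulr_ge0 ?(ltW e0).
  - by move=> m' r'; rewrite mulr_ge0 ?expR_ge0// exprn_ge0// ltW// ch_gt0.
  - by move=> j' r'; rewrite mulr_ge0 ?expR_ge0// exprn_ge0// ltW// ch_gt0.
  - move=> m' j' r'; rewrite exprS -mulrDr /ch.
    set A := expR (e * (m'.+1%:R - 2 * j'.+1%:R)).
    have -> : expR (e * (m'%:R - 2 * j'%:R)) = expR e * A.
      by rewrite -expRD; congr expR; rewrite -!natr1; ring.
    have -> : expR (e * (m'%:R - 2 * j'.+1%:R)) = expR (- e) * A.
      by rewrite -expRD; congr expR; rewrite -!natr1; ring.
    by rewrite le_eqVlt; apply/orP; left; apply/eqP; field.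
rewrite tail_baseX ler_wpM2l ?exprn_ge0 ?(ltW ch_gt0)// ler_expR.
have : e * (m%:R * (1 + e)) <= e * (2 * k%:R) by rewrite ler_wpM2l// ltW.
rewrite expr2; lra.
Qed.

(** This is [overflow_drift] divided by [m]: an exact block costs a factor [e] against a longer one,
    up to an exponentially small error. *)
Lemma hit_le m k : 1 <= e * m%:R -> hit m k <= e * exceed m k + tail_base ^+ m.
Proof.
move=> em; have m0 : 0 < m%:R :> R.
  by rewrite -(pmulr_rgt0 _ e0); apply: lt_le_trans em.
rewrite -(ler_pM2l m0); apply: le_trans (overflow_drift m k) _.
rewrite mulrDr mulrCA mulrA lerD2l ler_wpM2r ?tail_baseX_ge0//.
by rewrite -(ler_pM2l e0) divff ?gt_eqF.
Qed.

Lemma tail_base_le : e <= 3^-1 -> tail_base <= expR (- (e ^+ 2 / 4)).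
Proof.
move=> e3; suff ch_le : ch <= 1 + 3 / 4 * e ^+ 2.
  have -> : - (e ^+ 2 / 4) = 3 / 4 * e ^+ 2 + - e ^+ 2 by field.
  rewrite expRD ler_wpM2r ?expR_ge0// (le_trans ch_le)//; exact: expR_ge1Dx.
(* Halving the argument writes [ch] as 1 plus half a square, so a first-order bound on
   [expR y - expR (- y)] suffices; the slope 12/5 yields the coefficient 72/100, below 3/4. *)
set y := e / 2; have y0 : 0 < y by rewrite /y; move: e0; lra.
have y6 : y <= 6^-1 by rewrite /y; lra.
have ub : expR y <= (1 - y)^-1.
  rewrite -[expR y]invrK -expRN lef_pV2 ?posrE ?expR_gt0//; last by lra.
  exact: expR_ge1Dx.
have lb : 1 - y <= expR (- y) := expR_ge1Dx (- y).
have u1 : expR y * expR (- y) = 1 by exact: expRxMexpNx_1.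
have E : ch = 1 + (expR y - expR (- y)) ^+ 2 / 2.
  rewrite /ch; have -> : e = y + y by rewrite /y; field.
  rewrite opprD !expRD [in RHS]expr2 mulrBl !mulrBr [expR (- y) * expR y]mulrC u1.
  by field.
have d0 : 0 <= expR y - expR (- y) by rewrite subr_ge0 ler_expR; lra.
have d1 : expR y - expR (- y) <= 12 / 5 * y.
  apply: (@le_trans _ _ ((1 - y)^-1 - (1 - y))); first by lra.
  have y1 : 0 < 1 - y by lra.
  rewrite lerBlDr -(ler_pM2r y1) mulVf ?gt_eqF//.
  nra.
have d2 : (expR y - expR (- y)) ^+ 2 <= (12 / 5 * y) ^+ 2.
  by rewrite ler_sqr// nnegrE; lra.
have -> : e = 2 * y by rewrite /y; field.
by rewrite E; move: d2; rewrite !exprMn; nra.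
Qed.

End tails.

(** * Weights of a chain of sites *)

Section profile.
Context {R : realType}.
Implicit Types (par : seq (nat * nat)) (a c i k : nat).

(* [(i, c)] in [par] is a site receiving [i] extra visitors and visited at most
   [c] times; exactly [a] sites reach their cap. *)
Fixpoint weight par a k : R :=
  match par with
  | [::] => ((k == 0) && (a == 0))%:R
  | (i, c) :: par' =>
      block (fun m r =>
             if m is 0%N then (if a is a'.+1 then weight par' a' r else 0)
             else weight par' a r) c (k + i) 0
  end.

Lemma weight_ge0 par a k : 0 <= weight par a k.
Proof.
elim: par a k => [|[i c] par IH] a k /=; first by case: (_ && _).
by apply: block_ge0 => -[|m'] r' _ //; case: a.
Qed.

Lemma weight_le1 par a k : weight par a k <= 1.
Proof.
elim: par a k => [|[i c] par IH] a k /=; first by case: (_ && _).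
apply: (@le_trans _ _ (block (fun _ _ => 1) c (k + i) 0)).
  by apply: block_le => -[|m'] r' _ //; case: a.
by rewrite block1; have := @exceed_ge0 R c (k + i); lra.
Qed.

(** Splits on whether the first site attains its cap. If it does, its number of right steps is
    forced to be [c - (k + i)] and the rest of the chain factors out. *)
Lemma weight_cons i c par a k :
  weight ((i, c) :: par) a k =
  block (fun m r => if m is 0%N then 0 else weight par a r) c (k + i) 0 +
  (if a is a'.+1 then hit c (k + i) * weight par a' (c - (k + i)) else 0).
Proof.
case: a => [|a] /=; first by rewrite addr0.
have := @block_hit R (weight par a) c (k + i) 0; rewrite addn0 => <-.
by rewrite -blockD; apply: block_eq => -[|m'] r' _; rewrite ?add0r ?addr0.
Qed.

Lemma weight_cons_le (Phi : nat -> R) i c par a k :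
  (forall r, (r + (k + i) <= c)%N -> weight par a r <= Phi r) ->
  weight ((i, c) :: par) a k <=
  block (fun _ r => Phi r) c (k + i) 0 +
  (if a is a'.+1 then hit c (k + i) * weight par a' (c - (k + i)) else 0).
Proof.
move=> hPhi; rewrite weight_cons lerD2r; apply: block_le => -[|m'] r' E.
  by apply: le_trans (weight_ge0 par a r') _; apply: hPhi; lia.
by apply: hPhi; lia.
Qed.

Lemma weight_extinct n h a : (0 < h)%N -> weight (nseq n (0, h)%N) a 0 <= (a == 0)%:R.
Proof.
move=> h0; elim: n => [|n IH] /=; first by [].
by case: h h0 IH => [//|h] _ IH; rewrite addn0 /=; exact: IH.
Qed.

(** The flips make [j + r] a martingale, and [H] is large enough for the discarded overflow part to
    be nonnegative. *)
Lemma block_linear (H : R) m j r : (j + r + m)%:R <= H ->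
  block (fun _ r => H - r%:R) m j r <= H - (j + r)%:R.
Proof.
elim: m j r => [|m IH] [|j] r /= hH; rewrite ?add0n//.
  by rewrite subr_ge0; move: hH; rewrite addn0.
have /IH h1 : (j + r + m)%:R <= H.
  by apply: le_trans hH; rewrite ler_nat; lia.
have /IH h2 : (j.+1 + r.+1 + m)%:R <= H.
  by apply: le_trans hH; rewrite ler_nat; lia.
by move: h1 h2; rewrite !addSn !addnS -(natr1 (j + r).+1) -(natr1 (j + r)); lra.
Qed.

(** Each flip lowers the mean of [x * (H - x)], at [x = j + r], by one. Keeping the loss of the
    first flip gives a potential that pays for a constant error per generation. *)
Lemma block_quadratic (H : R) m j r : (j + r + m).+1%:R <= H ->
  block (fun _ r => r%:R * (H - r%:R)) m j r <=
  (j + r)%:R * (H - (j + r)%:R) - (0 < j)%:R.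
Proof.
elim: m j r => [|m IH] [|j] r /= hH; rewrite ?add0n ?subr0//.
  rewrite subr_ge0; apply: mulr_ege1; first by rewrite ler1n addSn.
  by move: hH; rewrite addn0 -natr1; lra.
have /IH h1 : (j + r + m).+1%:R <= H.
  by apply: le_trans hH; rewrite ler_nat; lia.
have /IH h2 : (j.+1 + r.+1 + m).+1%:R <= H.
  by apply: le_trans hH; rewrite ler_nat; lia.
have h3 : 0 <= (0 < j)%:R :> R by [].
move: h1 h2 h3; rewrite !addSn !addnS -(natr1 (j + r).+1) -(natr1 (j + r)) /=.
set x := (j + r)%:R; set b := (0 < j)%:R; move: (block _ m j r) (block _ m j.+1 _).
by move=> A B; nra.
Qed.

End profile.

(** * Sites to the left of the endpoint, summed over its distance to the origin *)

Section left_profile.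
Context {R : realType} (h : nat).
Implicit Types (b k n : nat).

(* [x] sites with one immigrant each, then the starting point of the walk, whose
   cap is larger by one since time 0 is not counted, then sites without
   immigration. *)
Definition left_weight n x b k : R :=
  weight (nseq x (1, h)%N ++ (1, h.+1)%N :: nseq n (0, h)%N) b k.

Lemma left_weight_ge0 n x b k : 0 <= left_weight n x b k. Proof. exact: weight_ge0. Qed.

(** Index [x] stands for the endpoint [x.+1]: the origin itself is one of the sites with an
    immigrant. *)
Definition left_sum n X b k : R := \sum_(x < X) left_weight n x b k.

Lemma left_sum_ge0 n X b k : 0 <= left_sum n X b k.
Proof. by apply: sumr_ge0 => x _; exact: left_weight_ge0. Qed.

(** All terms but [x = 0] start with the same immigrant site, whose block is factored out of the
    sum. *)
Lemma left_sum_succ n X b k :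
  left_sum n X.+1 b k = left_weight n 0 b k +
  (block (fun m r => if m is 0%N then 0 else left_sum n X b r) h k.+1 0 +
   (if b is b'.+1 then hit h k.+1 * left_sum n X b' (h - k.+1) else 0)).
Proof.
rewrite /left_sum big_ord_recl; congr (_ + _).
rewrite (eq_bigr (fun x : 'I_X =>
    block (fun m r => if m is 0%N then 0 else left_weight n x b r) h k.+1 0 +
    (if b is b'.+1 then hit h k.+1 * left_weight n x b' (h - k.+1) else 0))).
  rewrite big_split /= -block_sum; congr (_ + _).
    by apply: block_eq => -[|m] r _; rewrite ?big1_eq.
  by case: b => [|b]; rewrite ?big1_eq// mulr_sumr.
move=> x _; have := @weight_cons R 1 h
  (nseq x (1, h)%N ++ (1, h.+1)%N :: nseq n (0, h)%N) b k.
by rewrite addn1.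
Qed.

Lemma left_sum_succ_le (Phi : nat -> R) n X b k :
  (forall r, (r <= h)%N -> left_sum n X b r <= Phi r) -> (k <= h)%N ->
  left_sum n X.+1 b k <= left_weight n 0 b k + (block (fun _ r => Phi r) h k.+1 0 +
   (if b is b'.+1 then hit h k.+1 * left_sum n X b' (h - k.+1) else 0)).
Proof.
move=> hPhi kh; rewrite left_sum_succ lerD2l lerD2r; apply: block_le => m r E.
have rh : (r <= h)%N by rewrite -[h]addn0 -E addnAC leq_addl.
by case: m E => [|m] E; [apply: le_trans (left_sum_ge0 n X b r) _|]; exact: hPhi.
Qed.

Lemma block_lin k : (k <= h)%N ->
  block (fun _ r => 2 * h%:R + 2 - r%:R) h k.+1 0 <= 2 * h%:R + 2 - k%:R - 1 :> R.
Proof.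
move=> kh; have kh' : (k.+1 + 0 + h)%:R <= 2 * h%:R + 2 :> R.
  have : k%:R <= h%:R :> R by rewrite ler_nat.
  by rewrite addn0 addSn -(natr1 (k + h)) natrD; lra.
by have := block_linear _ _ _ _ kh'; rewrite addn0 -(natr1 k); lra.
Qed.

(** The immigrant makes [2 * h + 2 - r] drop by one in mean at each generation, which pays for the
    new term of weight at most 1. The bound is uniform in [X]. *)
Lemma left_sum_crude n X b k : (k <= h)%N -> left_sum n X b k <= 2 * h%:R + 2 - k%:R.
Proof.
elim: X b k => [|X IH] b k kh.
  rewrite /left_sum big_ord0; have : k%:R <= h%:R :> R by rewrite ler_nat.
  by have : 0 <= h%:R :> R by []; lra.
rewrite left_sum_succ.
have E1 : left_weight n 0 b k <= 1 by exact: weight_le1.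
suff : block (fun m r => if m is 0%N then 0 else left_sum n X b r) h k.+1 0 +
   (if b is b'.+1 then hit h k.+1 * left_sum n X b' (h - k.+1) else 0) <=
   block (fun _ r => 2 * h%:R + 2 - r%:R) h k.+1 0.
  by have := block_lin k kh; lra.
(* Rewriting the exact-cap term as a block supported on allowance 0 lets both cases be bounded
   inside one block. *)
have -> : (if b is b'.+1 then hit h k.+1 * left_sum n X b' (h - k.+1) else 0) =
   block (fun m r => if m is 0%N then (if b is b'.+1 then left_sum n X b' r else 0)
                   else 0) h k.+1 0.
  by rewrite block_hit addn0; case: (b) => [|b']; rewrite ?mulr0.
rewrite -blockD; apply: block_le => m r E.
have rh : (r <= h)%N by rewrite -[h]addn0 -E addnAC leq_addl.
case: m E => [|m] E; rewrite ?add0r ?addr0; last exact: IH.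
case: (b) => [|b']; last exact: IH.
have : 0 <= h%:R :> R by []; have : r%:R <= h%:R :> R by rewrite ler_nat.
by lra.
Qed.

End left_profile.


(** * Potential functions at a fixed level *)

Section potentials.
Context {R : realType} (e : R) (h : nat).
Context (e0 : 0 < e) (e_le : e <= 3^-1) (eh : 1 <= e * h%:R).
Local Notation dl := (tail_base e ^+ h).
Context (dl_small : 1200 * h%:R ^+ 2 * dl <= e ^+ 5).
Implicit Types (a b k n : nat).

Let h3 : 3 <= h%:R :> R.
Proof.
have : e * h%:R <= 3^-1 * h%:R by rewrite ler_wpM2r.
by move: eh; lra.
Qed.

Let h_gt0 : (0 < h)%N.
Proof. by rewrite -(ltr0n R); move: h3; lra. Qed.

Let dl0 : 0 <= dl. Proof. exact: tail_baseX_ge0. Qed.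

(* At overflow, the random walk made of the coin flips is mostly below [top], so
   that [pos (top - r)] is almost a supermartingale. *)
Definition pos (x : R) : R := Num.max 0 x.
Definition top : R := h%:R / 2 + 3 / 2 * (e * h%:R).

Lemma pos_ge0 x : 0 <= pos x. Proof. by rewrite /pos le_max lexx. Qed.

Lemma ge_pos x : x <= pos x. Proof. by rewrite /pos le_max lexx orbT. Qed.

Lemma pos_le x y : 0 <= y -> x <= y -> pos x <= y.
Proof. by rewrite /pos ge_max => -> ->. Qed.

Lemma pos_le_expR x : pos x <= x + e^-1 * expR (- (e * x)).
Proof.
have := ler_expR_div e e0 (- x); rewrite mulrN => hx.
apply: pos_le; first by lra.
by rewrite lerDl mulr_ge0 ?expR_ge0 ?invr_ge0 ?ltW.
Qed.

Let invh : e^-1 <= h%:R.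
Proof. by rewrite -(ler_pM2l e0) divff ?gt_eqF. Qed.

Let topE : h%:R / 2 <= top /\ top <= h%:R.
Proof.
rewrite /top; have : e * h%:R <= 3^-1 * h%:R by rewrite ler_wpM2r.
by move: eh; split; lra.
Qed.

(** For large [k] the block completes with probability at most [dl]. Otherwise [pos] is replaced by
    a linear function plus an exponential, and the gain [h * hit] in the optional stopping of the
    linear part is controlled by [overflow_drift]. *)
Lemma block_pos_le k :
  block (fun _ r => pos (top - r%:R)) h k 0 <= pos (top - k%:R) + 2 * h%:R * dl.
Proof.
have [k_small|k_big] := leP (2 * k%:R) (h%:R * (1 + e)); last first.
  apply: (@le_trans _ _ (top * dl)); last first.
    apply: (@le_trans _ _ (h%:R * dl)); first by rewrite ler_wpM2r//; case: topE.
    have := pos_ge0 (top - k%:R); have : 0 <= h%:R * dl by rewrite mulr_ge0.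
    by lra.
  apply: (@le_trans _ _ (top * block (fun _ _ => 1) h k 0)).
    rewrite -blockZ; apply: block_le => _ r _; rewrite mulr1.
    have [hh _] := topE; apply: pos_le; first by move: h3; lra.
    by have : 0 <= r%:R :> R by []; lra.
  rewrite ler_wpM2l//; first by have [hh _] := topE; move: h3; lra.
  by rewrite block1; apply: block1_le => //; exact: ltW.
apply: (@le_trans _ _ (block (fun _ r => (top * 1 + (-1) * r%:R) +
    e^-1 * expR (- (e * top)) * expR (e * r%:R)) h k 0)).
  apply: block_le => _ r _; apply: le_trans (pos_le_expR _) _.
  rewrite -[X in _ <= _ + X]mulrA -expRD.
  have -> : - (e * top) + e * r%:R = - (e * (top - r%:R)) by ring.
  lra.
rewrite (blockD (fun _ r => top * 1 + (-1) * r%:R)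
  (fun _ r => _ * expR (e * r%:R))).
rewrite (blockD (fun _ _ => top * 1) (fun _ r => (-1) * r%:R)).
rewrite (blockZ _ (fun _ _ => 1)) (blockZ _ (fun _ r => r%:R)).
rewrite (blockZ _ (fun _ r => expR (e * r%:R))) block1.
have -> : block (fun _ r => r%:R) h k 0 =
    k%:R * (1 - exceed h k) - h%:R * hit h k :> R.
  have hm (j r : nat) :
      (j.+1 + r)%:R = ((j + r)%:R + (j.+1 + r.+1)%:R) / 2 :> R.
    by rewrite !addSn !addnS -(natr1 (j + r).+1) -(natr1 (j + r)); field.
  have : block (fun _ r => r%:R) h k 0 + overflow (fun j r => (j + r)%:R) h k 0 =
      (k + 0)%:R :> R := @block_overflow_harmonic R (fun j r => (j + r)%:R) h k 0 hm.
  by rewrite overflow_martingale addn0 mulrBr mulr1; lra.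
have E2 : e^-1 * expR (- (e * top)) * block (fun _ r => expR (e * r%:R)) h k 0
    <= h%:R * dl.
  apply: (@le_trans _ _ (e^-1 * expR (- (e * top)) *
      (ch e ^+ h * expR (e * (k + 0)%:R)))).
    by rewrite ler_wpM2l ?block_expR// mulr_ge0 ?expR_ge0 ?invr_ge0 ?ltW.
  rewrite -mulrA; apply: ler_pM => //.
  - by rewrite invr_ge0 ltW.
  - by rewrite !mulr_ge0 ?expR_ge0// exprn_ge0 ?ltW ?ch_gt0.
  rewrite mulrCA -expRD addn0 tail_baseX ler_wpM2l ?exprn_ge0 ?(ltW (ch_gt0 e))//.
  rewrite ler_expR; have : e * (2 * k%:R) <= e * (h%:R * (1 + e)).
    by rewrite ler_wpM2l// ltW.
  by rewrite /top expr2; lra.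
have E1 := overflow_drift e e0 h k.
have E3 : e^-1 * dl <= h%:R * dl by rewrite ler_wpM2r.
(* The constant 3/2 in [top] makes [top - e * h] equal to the threshold [h * (1 + e) / 2] of the
   case distinction. *)
have E4 : 0 <= (top - k%:R - e * h%:R) * exceed h k.
  by rewrite mulr_ge0 ?exceed_ge0// /top; lra.
have E5 := ge_pos (top - k%:R).
move: E1 E2 E3 E4 E5; rewrite !mulrBl !mulrBr; lra.
Qed.


Local Notation Wh n a k := (weight (nseq n (0, h)%N) a k).
Local Notation H := (2 * h%:R + 1 : R).
Local Notation near k := (h%:R * (1 - e) <= 2 * (k%:R : R)).

Let quad_ge0 k : (k <= h)%N -> 0 <= k%:R * (H - k%:R).
Proof.
move=> kh; rewrite mulr_ge0// subr_ge0.
by have : k%:R <= h%:R :> R by [rewrite ler_nat]; move: h3; lra.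
Qed.

Let quad_le k : (k <= h)%N -> k%:R * (H - k%:R) <= 3 * h%:R ^+ 2.
Proof.
move=> kh; have kh' : k%:R <= h%:R :> R by rewrite ler_nat.
apply: (@le_trans _ _ (h%:R * (3 * h%:R))); last by rewrite expr2; lra.
have k0 : 0 <= k%:R :> R by [].
by apply: ler_pM => //; move: h3; lra.
Qed.

Let block_quad k : (0 < k)%N -> (k <= h)%N ->
  block (fun _ r => r%:R * (H - r%:R)) h k 0 <= k%:R * (H - k%:R) - 1.
Proof.
move=> k0 kh; have := @block_quadratic R H h k 0; rewrite addn0 k0; apply.
rewrite -(natr1 (k + h)) natrD; have : k%:R <= h%:R :> R by rewrite ler_nat.
by move: h3; lra.
Qed.

Let hit_leh k : hit h k <= e * exceed h k + dl.
Proof. exact: hit_le. Qed.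

(** An exact block is followed by [h - k] visitors; if this is well below [h / 2], then [k] left
    steps within [h] flips are exponentially unlikely. *)
Let hit_far k : ~~ near (h - k)%N -> (k <= h)%N -> hit h k <= dl.
Proof.
rewrite -ltNge => hk kh; apply: le_trans (hit_le_block1 _ _) _.
by apply: block1_le => //; move: hk; rewrite natrB//; lra.
Qed.

(** A gambler's ruin bound: the first term is at least 1 at extinction. The error of [block_pos_le],
    at most [4 * dl] after division by [top], is paid at each generation by the drop of the
    quadratic term. *)
Lemma weight_no_hit n k : (k <= h)%N ->
  Wh n 0%N k <= pos (top - k%:R) / top + 4 * dl * (k%:R * (H - k%:R)).
Proof.
have [htop1 htop2] := topE; have top0 : 0 < top by move: h3; lra.
have Phi0 m : (m <= h)%N ->
    0 <= pos (top - m%:R) / top + 4 * dl * (m%:R * (H - m%:R)).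
  move=> mh; rewrite addr_ge0// ?divr_ge0 ?pos_ge0 ?(ltW top0)//.
  by rewrite mulr_ge0 ?quad_ge0// mulr_ge0.
have Phi1 : 1 <= pos (top - 0%:R) / top + 4 * dl * (0%:R * (H - 0%:R)).
  rewrite mul0r mulr0 addr0 ler_pdivlMr// mul1r subr0; exact: ge_pos.
elim: n k => [|n IH] [|k] kh.
- exact: Phi1.
- exact: Phi0.
- by apply: le_trans Phi1; exact: weight_le1.
apply: le_trans (@weight_cons_le R
  (fun r => pos (top - r%:R) / top + 4 * dl * (r%:R * (H - r%:R)))
  0 h _ 0 k.+1 _) _.
  by move=> r hr; apply: IH; exact: leq_trans (leq_addr _ _) hr.
rewrite addr0 addn0.
under eq_fun do under eq_fun do rewrite [pos _ / _]mulrC.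
rewrite (blockD (fun _ r => top^-1 * pos (top - r%:R))).
rewrite (blockZ _ (fun _ r => pos (top - r%:R))).
rewrite (blockZ _ (fun _ r => r%:R * (H - r%:R))).
have E1 := block_pos_le k.+1; have E2 := block_quad k.+1 isT kh.
have E3 : 4 * dl * block (fun _ r => r%:R * (H - r%:R)) h k.+1 0 <=
    4 * dl * (k.+1%:R * (H - k.+1%:R) - 1) by rewrite ler_wpM2l// mulr_ge0.
have E4 : top^-1 * block (fun _ r => pos (top - r%:R)) h k.+1 0 <=
    top^-1 * (pos (top - k.+1%:R) + 2 * h%:R * dl).
  by rewrite ler_wpM2l// invr_ge0 ltW.
have E5 : top^-1 * (2 * h%:R * dl) <= 4 * dl.
  by rewrite mulrC ler_pdivrMr// [leRHS]mulrAC; apply: ler_wpM2r => //; lra.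
rewrite mulrDr in E4; rewrite mulrBr in E3; rewrite [_ / top]mulrC; lra.
Qed.

(** An exact block has at most [e] times the probability of an overflow, and overflow is fatal, so
    it happens at most once. The shares [exceed] and [1 - exceed] of [e * rho] add up, and the
    number of generations does not enter. *)
Lemma weight_hit_step n a k (rho : R) : 0 <= rho ->
  (forall n k, (k <= h)%N -> near k -> Wh n a k <= rho) -> (k <= h)%N ->
  Wh n a.+1 k <= e * rho + dl * (k%:R * (H - k%:R)).
Proof.
move=> rho0 hrho.
have Phi0 m : (m <= h)%N -> 0 <= e * rho + dl * (m%:R * (H - m%:R)).
  by move=> mh; rewrite addr_ge0// mulr_ge0 ?quad_ge0// ltW.
elim: n k => [|n IH] [|k] kh.
- exact: Phi0.
- exact: Phi0.
- by apply: le_trans (Phi0 0%N _) => //; apply: le_trans (weight_extinct _ _ _ _) _.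
apply: le_trans (@weight_cons_le R (fun r => e * rho + dl * (r%:R * (H - r%:R)))
  0 h _ a.+1 k.+1 _) _.
  by move=> r hr; apply: IH; exact: leq_trans (leq_addr _ _) hr.
rewrite addn0 (blockD (fun _ _ => e * rho) (fun _ r => dl * (r%:R * (H - r%:R)))).
rewrite (blockZ _ (fun _ r => r%:R * (H - r%:R))).
have -> : block (fun _ _ => e * rho) h k.+1 0 = e * rho * (1 - exceed h k.+1).
  by rewrite -(block1 _ _ 0) -blockZ; apply: block_eq => *; rewrite mulr1.
have E2 := block_quad k.+1 isT kh.
have E3 : dl * block (fun _ r => r%:R * (H - r%:R)) h k.+1 0 <=
    dl * (k.+1%:R * (H - k.+1%:R) - 1) by rewrite ler_wpM2l.
suff : hit h k.+1 * Wh n a (h - k.+1) <= e * rho * exceed h k.+1 + dl.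
  by rewrite !mulrBr in E3 *; lra.
have w0 := @weight_ge0 R (nseq n (0, h)%N) a (h - k.+1).
have w1 := @weight_le1 R (nseq n (0, h)%N) a (h - k.+1).
have x0 := @exceed_ge0 R h k.+1; have t0 := @hit_ge0 R h k.+1.
have [hn|hn] := boolP (near (h - k.+1)%N).
  apply: (@le_trans _ _ ((e * exceed h k.+1 + dl) * Wh n a (h - k.+1))).
    by rewrite ler_wpM2r.
  have wr := hrho n (h - k.+1)%N (leq_subr _ _) hn.
  rewrite mulrDl [e * rho * _]mulrAC; apply: lerD; last by rewrite ler_piMr.
  by rewrite ler_wpM2l// mulr_ge0// ltW.
apply: (@le_trans _ _ dl); last by rewrite lerDr !mulr_ge0 ?(ltW e0).
by apply: le_trans (hit_far _ hn kh); rewrite ler_piMr.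
Qed.

Let ee j : (j <= 5)%N -> e ^+ 5 <= e ^+ j.
Proof.
by move=> hj; apply: ler_wiXn2l => //; [exact: ltW|move: e_le; lra].
Qed.

Let dl_quad : 12 * dl * h%:R ^+ 2 <= e ^+ 5 / 100.
Proof. by move: dl_small; rewrite -!mulrA [dl * _]mulrC; lra. Qed.

(** With no exact block left, [near k] gives [top - k <= 2 * e * h]. For [a > 0] the starting point
    is free, because an exact block brings the process back near [h / 2] up to an error [dl]. *)
Lemma weight_le n a k : (a <= 3)%N -> (k <= h)%N -> (a == 0%N) ==> near k ->
  Wh n a k <= (5 + a)%:R * e ^+ a.+1.
Proof.
elim: a n k => [|a IH] n k a3 kh hk.
  apply: le_trans (weight_no_hit n k kh) _; rewrite addn0 expr1.
  have [htop1 htop2] := topE; have top0 : 0 < top by move: h3; lra.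
  have E1 : pos (top - k%:R) / top <= 4 * e.
    rewrite ler_pdivrMr//; apply: (@le_trans _ _ (2 * e * h%:R)).
      apply: pos_le; first by rewrite !mulr_ge0// ltW.
      by move: hk; rewrite /top /= ; lra.
    have : e * (h%:R / 2) <= e * top by rewrite ler_wpM2l// ltW.
    by lra.
  have E2 : 4 * dl * (k%:R * (H - k%:R)) <= 4 * dl * (3 * h%:R ^+ 2).
    by rewrite ler_wpM2l ?mulr_ge0// quad_le.
  by have := ee 1%N isT; have := dl_quad; rewrite expr1; move: e0; lra.
apply: le_trans (weight_hit_step n a k ((5 + a)%:R * e ^+ a.+1) _ _ kh) _.
- by rewrite mulr_ge0// exprn_ge0// ltW.
- by move=> n' k' kh' nk; apply: IH => //; [exact: ltnW|apply/implyP].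
have E2 : dl * (k%:R * (H - k%:R)) <= dl * (3 * h%:R ^+ 2).
  by rewrite ler_wpM2l ?mulr_ge0// quad_le.
have := ee a.+2 (leqW a3); have := dl_quad.
have e50 : 0 <= e ^+ 5 by rewrite exprn_ge0// ltW.
rewrite [e * (_ * _)]mulrCA -exprS addnS -(natr1 (5 + a)) mulrDl mul1r; lra.
Qed.


Lemma weight_le_unif n a k : (a <= 3)%N -> (k <= h)%N -> Wh n a k <= 3 * e ^+ a.
Proof.
case: a => [|a] a3 kh; first by apply: le_trans (weight_le1 _ _ _) _; rewrite expr0; lra.
apply: le_trans (weight_le n a.+1 k a3 kh _) _ => //.
rewrite [e ^+ a.+2]exprS mulrA ler_wpM2r ?exprn_ge0 ?(ltW e0)//.
have : (5 + a.+1)%:R <= 8 :> R by rewrite ler_nat addnC (leq_add2r 5 a.+1 3).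
have : e * (5 + a.+1)%:R <= 3^-1 * (5 + a.+1)%:R by rewrite ler_wpM2r.
by lra.
Qed.

Let dl_le_e : dl <= e.
Proof.
have : dl <= 1200 * h%:R ^+ 2 * dl.
  rewrite ler_peMl//; have : 3 * 3 <= h%:R * h%:R :> R by apply: ler_pM.
  by rewrite expr2; lra.
by have := ee 1%N isT; rewrite expr1; move: dl_small; lra.
Qed.

Let dlS : tail_base e ^+ h.+1 <= dl.
Proof.
rewrite exprS ler_piMl//; apply: le_trans (tail_base_le e e0 e_le) _.
by rewrite -[leRHS]expR0 ler_expR oppr_le0 divr_ge0// exprn_ge0// ltW.
Qed.

(** Either the origin misses its cap [h.+1], for at most [3 * e ^+ b], or it attains it at cost
    [2 * e] with one fewer exact block to come, for at most [6 * e ^+ b]. *)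
Lemma left_weight0_le n b k : (b <= 3)%N -> (k <= h)%N ->
  left_weight h n 0 b k <= 9 * e ^+ b.
Proof.
move=> b3 kh; rewrite /left_weight /=.
have eb0 (j : nat) : 0 <= e ^+ j by rewrite exprn_ge0// ltW.
apply: le_trans (@weight_cons_le R (fun _ => 3 * e ^+ b) 1 h.+1 _ b k _) _.
  move=> r; rewrite addn1 addnS ltnS => hr.
  by apply: weight_le_unif => //; exact: leq_trans (leq_addr _ _) hr.
have E1 : block (fun _ _ => 3 * e ^+ b) h.+1 (k + 1) 0 <= 3 * e ^+ b.
  apply: (@le_trans _ _ (3 * e ^+ b * block (fun _ _ => 1) h.+1 (k + 1) 0)).
    by rewrite -blockZ; apply: block_le => *; rewrite mulr1.
  by rewrite ler_piMr ?mulr_ge0// block1; have := @exceed_ge0 R h.+1 (k + 1); lra.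
case: b b3 E1 => [|b] b3 E1; first by move: E1; rewrite expr0; lra.
have E2 : hit h.+1 (k + 1) <= 2 * e.
  have eh1 : 1 <= e * h.+1%:R.
    by rewrite -(natr1 h) mulrDr mulr1; move: eh e0; lra.
  apply: le_trans (hit_le e e0 h.+1 (k + 1) eh1) _.
  have : e * exceed h.+1 (k + 1) <= e by rewrite ler_piMr ?exceed_le1// ltW.
  by have := dlS; have := dl_le_e; lra.
have E3 : hit h.+1 (k + 1) * Wh n b (h.+1 - (k + 1)) <= 2 * e * (3 * e ^+ b).
  apply: ler_pM => //; [exact: hit_ge0|exact: weight_ge0|].
  by apply: weight_le_unif; [exact: ltnW|rewrite addn1 subSS leq_subr].
by move: E1 E3; rewrite exprS; lra.
Qed.

(** Error per generation: 27 comes from the barrier term and 4 from exact blocks, both in units of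
    [h * dl]. *)
Let bigloss := 31 * h%:R * dl.

(** Three potentials are combined: the barrier term counts generations survived under immigration,
    [e * sigma] is shared between overflow and completion as in [weight_hit_step], and the linear
    term absorbs the errors. *)
Lemma left_sum_step n X b k (sigma : R) : 0 <= sigma -> (b <= 3)%N ->
  (forall b' X k, b = b'.+1 -> (k <= h)%N -> near k ->
     left_sum h n X b' k <= sigma) ->
  (k <= h)%N ->
  left_sum h n X b k <= 9 * e ^+ b * (pos (top - k%:R) + 1) + e * sigma +
    bigloss * (2 * h%:R + 2 - k%:R).
Proof.
move=> s0 b3 hs.
have eb0 : 0 <= e ^+ b by rewrite exprn_ge0// ltW.
have eb1 : e ^+ b <= 1 by rewrite exprn_ile1// ?ltW//; move: e_le; lra.
have bl0 : 0 <= bigloss by rewrite !mulr_ge0.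
have Phi0 m : (m <= h)%N ->
    0 <= 9 * e ^+ b * (pos (top - m%:R) + 1) + e * sigma +
    bigloss * (2 * h%:R + 2 - m%:R).
  move=> mh; have mh' : m%:R <= h%:R :> R by rewrite ler_nat.
  have : 0 <= 2 * h%:R + 2 - m%:R :> R by move: h3; lra.
  move: (_ - m%:R) => z z0.
  by rewrite !(addr_ge0, mulr_ge0, pos_ge0)// ltW.
elim: X k => [|X IH] k kh; first by rewrite /left_sum big_ord0; exact: Phi0.
apply: le_trans (@left_sum_succ_le R h _ n X b k (fun r hr => IH r hr) kh) _.
have W0 := left_weight0_le n b k b3 kh.
rewrite (blockD (fun _ r => 9 * e ^+ b * (pos (top - r%:R) + 1) + e * sigma)
  (fun _ r => bigloss * (2 * h%:R + 2 - r%:R))).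
rewrite (blockD (fun _ r => 9 * e ^+ b * (pos (top - r%:R) + 1))
  (fun _ _ => e * sigma)).
rewrite (blockZ _ (fun _ r => pos (top - r%:R) + 1)).
rewrite (blockZ _ (fun _ r => 2 * h%:R + 2 - r%:R)).
have -> : block (fun _ _ => e * sigma) h k.+1 0 = e * sigma * (1 - exceed h k.+1).
  by rewrite -(block1 _ _ 0) -blockZ; apply: block_eq => *; rewrite mulr1.
have E1 := ler_wpM2l bl0 (block_lin h k kh).
(* one immigrant lowers the barrier term by one, which pays for the new site *)
have E2 : block (fun _ r => pos (top - r%:R) + 1) h k.+1 0 <=
    pos (top - k%:R) + 3 * h%:R * dl.
  rewrite (blockD (fun _ r => pos (top - r%:R)) (fun _ _ => 1)) block1.
  have hdl : 0 <= h%:R * dl by rewrite mulr_ge0.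
  have ex0 := @exceed_ge0 R h k.+1.
  have [_ topl] := topE.
  have [k_small|k_big] := leP k.+1%:R top.
    have := block_pos_le k.+1; have := ge_pos (top - k%:R).
    have -> : pos (top - k.+1%:R) = top - k.+1%:R.
      by rewrite /pos; apply/max_idPr; rewrite subr_ge0.
    by rewrite -(natr1 k); lra.
  have E3 : 1 - exceed h k.+1 <= dl.
    by apply: block1_le => //; move: k_big; rewrite /top; move: eh e0; lra.
  have E4 : block (fun _ r => pos (top - r%:R)) h k.+1 0 <= 2 * h%:R * dl.
    apply: le_trans (block_pos_le _) _.
    have -> : pos (top - k.+1%:R) = 0; last by rewrite add0r.
    by rewrite /pos; apply/max_idPl; rewrite subr_le0 ltW.
  have : dl <= h%:R * dl by rewrite ler_peMl//; move: h3; lra.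
  by have := pos_ge0 (top - k%:R); lra.
have E3 : 9 * e ^+ b * block (fun _ r => pos (top - r%:R) + 1) h k.+1 0 <=
    9 * e ^+ b * pos (top - k%:R) + 27 * h%:R * dl.
  apply: le_trans (ler_wpM2l _ E2) _; first by rewrite mulr_ge0.
  rewrite mulrDr lerD2l.
  have : e ^+ b * (h%:R * dl) <= 1 * (h%:R * dl).
    by rewrite ler_wpM2r// mulr_ge0.
  by rewrite !mulrA; lra.
have E4 : (if b is b'.+1 then hit h k.+1 * left_sum h n X b' (h - k.+1) else 0) <=
    e * sigma * exceed h k.+1 + 4 * h%:R * dl.
  have ex0 := @exceed_ge0 R h k.+1; have t0 := @hit_ge0 R h k.+1.
  have r0 : 0 <= e * sigma * exceed h k.+1 by rewrite !mulr_ge0// ltW.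
  have hd0 : 0 <= 4 * h%:R * dl by rewrite !mulr_ge0.
  move: hs; case: (b) => [_|b' hs]; first by rewrite addr_ge0.
  have L0 := @left_sum_ge0 R h n X b' (h - k.+1).
  have L1 : left_sum h n X b' (h - k.+1) <= 4 * h%:R :> R.
    apply: le_trans (@left_sum_crude R h _ _ _ _ (leq_subr _ _)) _.
    have : 0 <= (h - k.+1)%:R :> R by [].
    by move: h3; lra.
  have [hn|hn] := boolP (near (h - k.+1)%N).
    apply: (@le_trans _ _ ((e * exceed h k.+1 + dl) * left_sum h n X b' (h - k.+1))).
      by rewrite ler_wpM2r.
    have Ls := hs b' X (h - k.+1)%N erefl (leq_subr _ _) hn.
    rewrite mulrDl [e * sigma * _]mulrAC; apply: lerD.
      by rewrite ler_wpM2l// mulr_ge0// ltW.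
    by rewrite mulrC ler_wpM2r.
  apply: (@le_trans _ _ (4 * h%:R * dl)); last by rewrite lerDr.
  rewrite mulrC; apply: ler_pM => //.
  (* When [k = h], the truncated [h - k.+1] is 0 and [hit_far] does not apply; the tail bound is
     then used directly. *)
  have [kh'|] := leqP k.+1 h; first exact: hit_far.
  rewrite ltnS => hk; apply: le_trans (hit_le_block1 _ _) _.
  apply: block1_le => //; rewrite -(natr1 k).
  have : h%:R <= k%:R :> R by rewrite ler_nat.
  have : e * h%:R <= 3^-1 * h%:R by rewrite ler_wpM2r.
  by move: h3; lra.
have E5 : bigloss * (2 * h%:R + 2 - k%:R - 1) =
  bigloss * (2 * h%:R + 2 - k%:R) - bigloss by ring.
have E6 : e * sigma * (1 - exceed h k.+1) = e * sigma - e * sigma * exceed h k.+1.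
  by ring.
have E7 : bigloss = 27 * h%:R * dl + 4 * h%:R * dl by rewrite /bigloss; ring.
have E8 : 9 * e ^+ b * (pos (top - k%:R) + 1) =
  9 * e ^+ b * pos (top - k%:R) + 9 * e ^+ b by ring.
rewrite E5 in E1; rewrite E6 E8.
move: W0 E1 E3 E4 E7; move: (bigloss * _) (bigloss * _) => A B.
move: (9 * e ^+ b * _) => C; move: (9 * e ^+ b * _) => D.
move: (9 * e ^+ b) (bigloss) => G bl.
move: (if b is b'.+1 then hit h k.+1 * left_sum h n X b' (h - k.+1) else 0) => L.
lra.
Qed.

(** By induction on [b]: near [h / 2] the barrier term is at most [3 * e * h], which contributes 27
    per level, and the errors at most 1. *)
Lemma left_sum_le n X b k : (b <= 3)%N -> (k <= h)%N -> near k ->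
  left_sum h n X b k <= (28 * b.+1)%:R * (e ^+ b.+1 * h%:R).
Proof.
have e50 : 0 <= e ^+ 5 by rewrite exprn_ge0// ltW.
have E1 : bigloss * (2 * h%:R + 2) <= e ^+ 5.
  apply: (@le_trans _ _ (bigloss * (4 * h%:R))).
    by rewrite ler_wpM2l ?mulr_ge0//; move: h3; lra.
  have -> : bigloss * (4 * h%:R) = 124 * h%:R ^+ 2 * dl by rewrite /bigloss; ring.
  have : 0 <= h%:R ^+ 2 * dl by rewrite mulr_ge0// exprn_ge0.
  by have := dl_small; rewrite -!mulrA; lra.
have bl0 : 0 <= bigloss by rewrite !mulr_ge0.
have E2 k' : bigloss * (2 * h%:R + 2 - k'%:R) <= e ^+ 5.
  apply: le_trans E1; rewrite ler_wpM2l//.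
  by have : 0 <= k'%:R :> R by []; lra.
have pos_near k' : near k' -> pos (top - k'%:R) + 1 <= 3 * (e * h%:R).
  move=> hk; rewrite (_ : 3 * _ = 2 * (e * h%:R) + e * h%:R); last by ring.
  apply: lerD => //; apply: pos_le; first by rewrite !mulr_ge0// ltW.
  by move: hk; rewrite /top; lra.
have e5b j : (j <= 5)%N -> e ^+ 5 <= e ^+ j * h%:R.
  move=> hj; apply: le_trans (ee j hj) _; rewrite ler_peMr ?exprn_ge0 ?(ltW e0)//.
  by move: h3; lra.
elim: b n X k => [|b IH] n X k b3 kh hk.
  apply: le_trans (left_sum_step n X 0 k 0 _ _ _ kh) _ => //.
  have := pos_near k hk; have := E2 k; have := e5b 1%N isT.
  by rewrite mulr0 addr0 expr0 expr1; lra.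
set sigma := (28 * b.+1)%:R * (e ^+ b.+1 * h%:R).
apply: le_trans (left_sum_step n X b.+1 k sigma _ b3 _ kh) _.
- by rewrite /sigma !mulr_ge0// exprn_ge0// ltW.
- by move=> b' X' k' [<-] kh' nk; apply: IH => //; exact: ltnW.
have E3 : 9 * e ^+ b.+1 * (pos (top - k%:R) + 1) <= 27 * (e ^+ b.+2 * h%:R).
  have -> : 27 * (e ^+ b.+2 * h%:R) = 9 * e ^+ b.+1 * (3 * (e * h%:R)).
    by rewrite [e ^+ b.+2]exprS; ring.
  by rewrite ler_wpM2l ?pos_near// mulr_ge0// exprn_ge0// ltW.
have E4 : e * sigma = (28 * b.+1)%:R * (e ^+ b.+2 * h%:R).
  by rewrite /sigma [e ^+ b.+2]exprS; ring.
have := E2 k; have := e5b b.+2 (leqW b3).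
rewrite E4 [(28 * b.+2)%N]mulnS natrD mulrDl; lra.
Qed.

(** Mean of [f (u + B)] with [B] binomial of parameters [m] and 1/2: among the steps out of the
    endpoint, [B] counts those to the right. *)
Fixpoint bin (f : nat -> R) m u : R :=
  if m is m'.+1 then (bin f m' u.+1 + bin f m' u) / 2 else f u.

Lemma bin_le f g m u : (forall v, (v <= m + u)%N -> f v <= g v) ->
  bin f m u <= bin g m u.
Proof.
elim: m u => [|m IH] u fg /=; first exact: fg.
have h1 : bin f m u.+1 <= bin g m u.+1.
  by apply: IH => v hv; apply: fg; rewrite addSn -addnS.
have h2 : bin f m u <= bin g m u.
  by apply: IH => v hv; apply: fg; rewrite addSn leqW.
lra.
Qed.

Lemma binD f g m u : bin (fun v => f v + g v) m u = bin f m u + bin g m u.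
Proof. by elim: m u => [|m IH] u //=; rewrite !IH; lra. Qed.

Lemma binZ c f m u : bin (fun v => c * f v) m u = c * bin f m u.
Proof. by elim: m u => [|m IH] u //=; rewrite !IH; lra. Qed.

Lemma bin_const c m u : bin (fun _ => c) m u = c.
Proof. by elim: m u => [|m IH] u //=; rewrite !IH; lra. Qed.

Lemma bin_expR t m u :
  bin (fun v => expR (t * (2 * v%:R))) m u =
  ch t ^+ m * expR (t * (2 * u%:R + m%:R)).
Proof.
elim: m u => [|m IH] u /=; first by rewrite expr0 mul1r addr0.
rewrite !IH exprS /ch.
set A := expR (t * (2 * u%:R + m.+1%:R)).
have -> : expR (t * (2 * u.+1%:R + m%:R)) = expR t * A.
  by rewrite -expRD; congr expR; rewrite -(natr1 u) -(natr1 m); ring.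
have -> : expR (t * (2 * u%:R + m%:R)) = expR (- t) * A.
  by rewrite -expRD; congr expR; rewrite -(natr1 m); ring.
by field.
Qed.

Let expR_e_le2 : expR e <= 2.
Proof.
rewrite -[expR e]invrK -expRN -[leRHS]invrK lef_pV2 ?posrE ?expR_gt0//.
by have := expR_ge1Dx (- e); move: e_le; lra.
Qed.

(** Endpoints away from the origin. If both sides start near [h / 2], their bounds multiply to
    [e ^+ (a.+1 + b.+1) * h], with 896 = 8 * 28 * 4; an unbalanced binomial split is exponentially
    unlikely. *)
Lemma profile_pos_le n n' X a b : (a + b = 3)%N ->
  bin (fun u => Wh n a u * left_sum h n' X b (h.-1 - u)) h.-1 0 <=
  897 * (e ^+ 5 * h%:R).
Proof.
move=> ab; have a3 : (a <= 3)%N by rewrite -ab leq_addr.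
have b3 : (b <= 3)%N by rewrite -ab leq_addl.
have e50 : 0 <= e ^+ 5 by rewrite exprn_ge0// ltW.
have h1E : h.-1%:R + 1 = h%:R :> R by rewrite natr1 prednK.
have e5h0 : 0 <= e ^+ 5 * h%:R := mulr_ge0 e50 (ler0n _ _).
(* One of the two exponential tilts is at least 1 when the split is unbalanced; the extra [e] in the
   exponent makes up for [h.-1] in place of [h]. *)
pose c := expR (- (e ^+ 2 * h%:R) + e).
pose Ep (v : nat) := c * (expR (- (e * h.-1%:R)) * expR (e * (2 * v%:R))).
pose Em (v : nat) := c * (expR (e * h.-1%:R) * expR (- e * (2 * v%:R))).
apply: (@le_trans _ _ (bin (fun v => 896 * (e ^+ 5 * h%:R) +
    4 * h%:R * (Ep v + Em v)) h.-1 0)).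
  apply: bin_le => v; rewrite addn0 => vh.
  have vh' : (v <= h)%N := leq_trans vh (leq_pred h).
  have E0 : 0 <= Ep v + Em v by rewrite addr_ge0 ?mulr_ge0 ?expR_ge0.
  have w0 := @weight_ge0 R (nseq n (0, h)%N) a v.
  have l0 := @left_sum_ge0 R h n' X b (h.-1 - v).
  have sub_h : (h.-1 - v <= h)%N := leq_trans (leq_subr _ _) (leq_pred h).
  have [/andP[n1 n2]|] := boolP (near v && near (h.-1 - v)%N).
    have W1 : Wh n a v <= (5 + a)%:R * e ^+ a.+1.
      by apply: weight_le => //; apply/implyP.
    have W2 := left_sum_le n' X b (h.-1 - v)%N b3 sub_h n2.
    apply: (@le_trans _ _ (896 * (e ^+ 5 * h%:R))); last first.
      rewrite lerDl; exact: mulr_ge0 (mulr_ge0 (ler0n _ _) (ler0n _ _)) E0.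
    apply: le_trans (ler_pM w0 l0 W1 W2) _.
    have -> : (5 + a)%:R * e ^+ a.+1 * ((28 * b.+1)%:R * (e ^+ b.+1 * h%:R)) =
        ((5 + a) * (28 * b.+1))%:R * (e ^+ (a.+1 + b.+1) * h%:R).
      by rewrite [in RHS]natrM exprD; ring.
    have -> : (a.+1 + b.+1 = 5)%N by rewrite addSn addnS ab.
    rewrite ler_wpM2r//.
    have A8 : (5 + a)%:R <= 8 :> R by rewrite ler_nat (leq_add2l 5 a 3).
    have B4 : b.+1%:R <= 4 :> R by rewrite ler_nat ltnS.
    have : (5 + a)%:R * b.+1%:R <= 8 * 4 :> R by apply: ler_pM.
    by rewrite natrM [(28 * _)%:R]natrM mulrCA; lra.
  rewrite negb_and -!ltNge => far.
  apply: (@le_trans _ _ (4 * h%:R * (Ep v + Em v))); last first.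
    by rewrite lerDr; exact: mulr_ge0 (ler0n _ _) e5h0.
  have L1 : left_sum h n' X b (h.-1 - v) <= 4 * h%:R :> R.
    apply: le_trans (@left_sum_crude R h _ _ _ _ sub_h) _.
    have : 0 <= (h.-1 - v)%:R :> R by [].
    by move: h3; lra.
  apply: (@le_trans _ _ (1 * (4 * h%:R))).
    by apply: ler_pM => //; exact: weight_le1.
  rewrite mul1r ler_peMr ?mulr_ge0//.
  have EpE : Ep v = expR (e * (2 * v%:R - h.-1%:R - e * h%:R + 1)).
    by rewrite /Ep /c -!expRD; congr expR; ring.
  have EmE : Em v = expR (e * (h.-1%:R - 2 * v%:R - e * h%:R + 1)).
    by rewrite /Em /c -!expRD; congr expR; ring.
  have gt1 (x : R) : 0 <= x -> 1 <= expR (e * x).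
    by move=> x0; rewrite -expR0 ler_expR mulr_ge0// ltW.
  case/orP: far => far.
    have : 1 <= Em v by rewrite EmE; apply: gt1; move: far h1E; lra.
    by have : 0 <= Ep v by [rewrite EpE expR_ge0]; lra.
  have : 1 <= Ep v.
    by rewrite EpE; apply: gt1; move: far h1E; rewrite natrB//; lra.
  by have : 0 <= Em v by [rewrite EmE expR_ge0]; lra.
rewrite (binD (fun _ => _) (fun v => 4 * h%:R * (Ep v + Em v))) bin_const.
rewrite binZ (binD Ep Em) /Ep /Em.
rewrite (binZ c (fun v => expR (- (e * h.-1%:R)) * expR (e * (2 * v%:R)))).
rewrite (binZ c (fun v => expR (e * h.-1%:R) * expR (- e * (2 * v%:R)))).
rewrite (binZ _ (fun v => expR (e * (2 * v%:R)))).
rewrite (binZ _ (fun v => expR (- e * (2 * v%:R)))) !bin_expR.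
have -> : ch (- e) = ch e by rewrite /ch opprK addrC.
have -> : expR (- (e * h.-1%:R)) *
    (ch e ^+ h.-1 * expR (e * (2 * 0%:R + h.-1%:R))) = ch e ^+ h.-1.
  rewrite mulrCA -expRD (_ : _ + _ = 0) ?expR0 ?mulr1//; ring.
have -> : expR (e * h.-1%:R) *
    (ch e ^+ h.-1 * expR (- e * (2 * 0%:R + h.-1%:R))) = ch e ^+ h.-1.
  rewrite mulrCA -expRD (_ : _ + _ = 0) ?expR0 ?mulr1//; ring.
have E1 : c * ch e ^+ h.-1 <= 2 * dl.
  rewrite /c expRD tail_baseX.
  have : ch e ^+ h.-1 <= ch e ^+ h.
    rewrite -[in leRHS](prednK h_gt0) exprS ler_peMl ?ch_ge1//.
    by rewrite exprn_ge0// (ltW (ch_gt0 e)).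
  set x := expR (- _) => E1.
  rewrite [x * _]mulrC -mulrA.
  have x0 : 0 <= x := expR_ge0 _.
  have p0 : 0 <= ch e ^+ h.-1 by rewrite exprn_ge0// (ltW (ch_gt0 e)).
  apply: (ler_pM (expR_ge0 e) (mulr_ge0 x0 p0) expR_e_le2).
  by rewrite mulrC ler_wpM2r.
have E2 : 4 * h%:R * (c * ch e ^+ h.-1 + c * ch e ^+ h.-1) <= 16 * h%:R * dl.
  have -> : 16 * h%:R * dl = 4 * h%:R * (2 * dl + 2 * dl) by ring.
  by apply: ler_wpM2l; [rewrite mulr_ge0|exact: lerD].
have E3 : 16 * h%:R * dl <= e ^+ 5.
  apply: le_trans dl_small; rewrite ler_wpM2r// expr2.
  have : h%:R <= h%:R * h%:R :> R by rewrite ler_peMl//; move: h3; lra.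
  by move: h3; lra.
have : e ^+ 5 <= e ^+ 5 * h%:R by rewrite ler_peMr//; move: h3; lra.
lra.
Qed.

(** Endpoint at the origin: there is no sum over positions, so [e ^+ 4] is enough. One of [a], [b]
    is positive and gives an extra factor [e] without any concentration of the split. *)
Lemma profile0_le n n' a b : (a + b = 3)%N ->
  bin (fun u => Wh n a u * Wh n' b (h - u)) h 0 <= 24 * (e ^+ 5 * h%:R).
Proof.
move=> ab; have a3 : (a <= 3)%N by rewrite -ab leq_addr.
have b3 : (b <= 3)%N by rewrite -ab leq_addl.
have eb0 (j : nat) : 0 <= e ^+ j by rewrite exprn_ge0// ltW.
have e4 : e ^+ 4 <= e ^+ 5 * h%:R.
  by rewrite [e ^+ 5]exprSr -mulrA ler_peMr.
have key c d k l n1 n2 : (c.+1 + d = 3)%N -> (k <= h)%N -> (l <= h)%N ->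
    Wh n1 c.+1 k * Wh n2 d l <= 24 * (e ^+ 5 * h%:R).
  move=> cd kh lh; have c3 : (c.+1 <= 3)%N by rewrite -cd leq_addr.
  have d3 : (d <= 3)%N by rewrite -cd leq_addl.
  have E1 := weight_le n1 c.+1 k c3 kh isT; have E2 := weight_le_unif n2 d l d3 lh.
  apply: le_trans (ler_pM (weight_ge0 _ _ _) (weight_ge0 _ _ _) E1 E2) _.
  rewrite mulrACA -exprD (_ : (c.+2 + d = 4)%N); last by rewrite addSn cd.
  apply: (@le_trans _ _ (24 * e ^+ 4)); last by rewrite ler_pM2l.
  rewrite ler_wpM2r//.
  have : (5 + c.+1)%:R <= 8 :> R by rewrite ler_nat (leq_add2l 5 c.+1 3).
  by lra.
rewrite -[leRHS](bin_const _ h 0); apply: bin_le => v; rewrite addn0 => vh.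
case: a ab {a3} => [|a] ab; last by apply: key => //; exact: leq_subr.
by case: b ab {b3} => [|b] // ab; rewrite mulrC; apply: key; rewrite ?addn0 ?leq_subr.
Qed.

End potentials.

(** * Finite paths and their stacks *)

Section paths.
Implicit Types (p q s : seq bool) (z y x : int).

Definition step (z : int) (b : bool) : int := if b then z + 1 else z - 1.

Fixpoint endp z p : int := if p is b :: p' then endp (step z b) p' else z.

Fixpoint visits z p y : nat :=
  if p is b :: p' then ((step z b == y) + visits (step z b) p' y)%N else 0%N.

(* The successive steps out of [y], [true] being a step to the right. *)
Fixpoint stack z p y : seq bool :=
  if p is b :: p' then
    (if z == y then cons b else id) (stack (step z b) p' y)
  else [::].

(** The next step is always the head of the stack at the current position. *)
Lemma stack_inj z p q : (forall y, stack z p y = stack z q y) -> p = q.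
Proof.
elim: p z q => [|b p IH] z [|c q] //= E; try by have := E z; rewrite eqxx.
have := E z; rewrite eqxx => -[bc _]; move: E; rewrite -{}bc => E.
congr cons; apply: (IH (step z b)) => y; have := E y.
by case: eqP => // _ [].
Qed.

(** The endpoint is a visit without a departure, and the start a departure without a counted
    visit. *)
Lemma size_stack z p y :
  (size (stack z p y) + (endp z p == y) = visits z p y + (z == y))%N.
Proof.
elim: p z => [|b p IH] z //=; have := IH (step z b).
by case: (z == y) => /=; lia.
Qed.

Lemma stack_nil z p y : (size p <= `|y - z|)%N -> stack z p y = [::].
Proof.
elim: p z => [|b p IH] z //= H.
have -> : (z == y) = false by apply/eqP; lia.
by apply: IH; rewrite /step; case: b; lia.
Qed.

(** The crossings of the edge from [y] to [y + 1] alternate in direction. *)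
Lemma stack_balance z p y :
  (count id (stack z p y) + (y < z)%R =
   count negb (stack z p (y + 1)) + (y < endp z p)%R)%N.
Proof.
elim: p z => [|b p IH] z //=; have := IH (step z b).
rewrite /step; case: b; case: eqP; case: eqP => /=; lia.
Qed.

(** A site to the right of the endpoint is last left by a left step; the default [false] covers
    sites never left. *)
Lemma last_stack_right z p y : endp z p < y -> last false (stack z p y) = false.
Proof.
suff H : endp z p < y -> last false (stack z p y) = false /\
    (stack z p y = [::] -> z < y) by move=> /H [].
elim: p z => [|b p IH] z //= Hy; have [IH1 IH2] := IH _ Hy.
case: eqP => [zy|zy] /=.
  split=> //; case E: (stack _ p y) IH1 IH2 => [|c s] // _ /(_ erefl).
  by rewrite zy /step; case: b {Hy E} => //=; lia.
split=> // /IH2; move: zy; rewrite /step; case: b {Hy IH1 IH2}; lia.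
Qed.

Lemma last_stack_left z p y : y < endp z p -> last true (stack z p y) = true.
Proof.
suff H : y < endp z p -> last true (stack z p y) = true /\
    (stack z p y = [::] -> y < z) by move=> /H [].
elim: p z => [|b p IH] z //= Hy; have [IH1 IH2] := IH _ Hy.
case: eqP => [zy|zy] /=.
  split=> //; case E: (stack _ p y) IH1 IH2 => [|c s] // _ /(_ erefl).
  by rewrite zy /step; case: b {Hy E} => //=; lia.
split=> // /IH2; move: zy; rewrite /step; case: b {Hy IH1 IH2}; lia.
Qed.

Lemma sum_size_stack z p (sites : seq int) : uniq sites ->
  (forall y, (`|y - z| < size p)%N -> y \in sites) ->
  (\sum_(y <- sites) size (stack z p y) = size p)%N.
Proof.
move=> us; elim: p z => [|b p IH] z /= hs; first by rewrite big1_seq.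
rewrite (eq_bigr (fun y => (z == y) + size (stack (step z b) p y))%N).
  rewrite big_split /= IH.
    rewrite -add1n; congr (_ + _)%N; apply: (@etrans _ _ (count_mem z sites)).
      rewrite -sum1_count [RHS]big_mkcond /=; apply: eq_bigr => i _.
      by rewrite eq_sym; case: eqP.
    by rewrite count_uniq_mem// hs//; lia.
  by move=> y Hy; apply: hs; move: Hy; rewrite /step; case: b; lia.
by move=> y _; case: eqP.
Qed.

Fixpoint rsites y n : seq int :=
  if n is n'.+1 then y + 1 :: rsites (y + 1) n' else [::].

Fixpoint lsites y n : seq int :=
  if n is n'.+1 then y - 1 :: lsites (y - 1) n' else [::].

Lemma mem_rsites y n z : (z \in rsites y n) = (y < z <= y + n%:Z).
Proof.
elim: n y => [|n IH] y /=; first by rewrite in_nil; lia.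
by rewrite in_cons IH; lia.
Qed.

Lemma mem_lsites y n z : (z \in lsites y n) = (y - n%:Z <= z < y).
Proof.
elim: n y => [|n IH] y /=; first by rewrite in_nil; lia.
by rewrite in_cons IH; lia.
Qed.

Lemma uniq_sites x n n' : uniq (x :: rsites x n ++ lsites x n').
Proof.
have ur y m : uniq (rsites y m).
  by elim: m y => [|m IH] y //=; rewrite IH mem_rsites andbT; lia.
have ul y m : uniq (lsites y m).
  by elim: m y => [|m IH] y //=; rewrite IH mem_lsites andbT; lia.
rewrite /= cat_uniq ur ul mem_cat mem_rsites mem_lsites !andbT /=.
apply/andP; split; first by lia.
by apply/hasPn => y; rewrite /= mem_lsites mem_rsites; lia.
Qed.

End paths.

(** * Enumerating stacks so that their total weight is computed by the recursions *)

Section coding.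
Implicit Types (p s : seq bool) (a k m j : nat).

Fixpoint bits m : seq (seq bool) :=
  if m is m'.+1 then map (cons true) (bits m') ++ map (cons false) (bits m')
  else [:: [::]].

Lemma mem_bits m s : (s \in bits m) = (size s == m).
Proof.
have inj c : injective (cons c : seq bool -> seq bool) by move=> ? ? [].
elim: m s => [|m IH] [|[] s] //=; rewrite ?mem_cat.
- by apply/negP => /orP[] /mapP[].
- rewrite mem_map// IH eqSS; case: (size s == m) => //=.
  by apply/negP => /mapP[].
- by rewrite orbC mem_map// IH eqSS; case: (size s == m) => //=; apply/negP => /mapP[].
Qed.

Lemma uniq_bits m : uniq (bits m).
Proof.
have inj c : injective (cons c : seq bool -> seq bool) by move=> ? ? [].
elim: m => [|m IH] //=; rewrite cat_uniq !map_inj_uniq// IH andbT /=.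
by apply/hasPn => s /mapP[t _ ->]; apply/negP => /mapP[].
Qed.

(** The stacks summed by [block]: at most [m] steps, [j] of them to the left, none after the last
    left step. *)
Fixpoint cand m j : seq (seq bool) :=
  match j, m with
  | 0%N, _ => [:: [::]]
  | _.+1, 0%N => [::]
  | j'.+1, m'.+1 => map (cons false) (cand m' j') ++ map (cons true) (cand m' j)
  end.

Lemma cand_size m j s : s \in cand m j -> (size s <= m)%N.
Proof.
elim: m j s => [|m IH] [|j] s //=; rewrite ?inE; try by move/eqP ->.
by rewrite mem_cat => /orP[] /mapP[t /IH ht ->].
Qed.

Lemma mem_cand m j s : (size s <= m)%N -> count negb s = j ->
  last false s = false -> s \in cand m j.
Proof.
elim: m j s => [|m IH] j [|b s] //=; try by move=> _ <-.
rewrite ltnS => sm; case: b => /=.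
  rewrite add0n => sj hl; case: j sj => [|j] sj.
    case: s hl sj {sm} => //= b s hl sj.
    have : has negb (b :: s) by apply/hasP; exists (last b s); rewrite ?mem_last ?hl.
    by rewrite has_count /= sj.
  rewrite mem_cat; apply/orP; right; apply: map_f; apply: IH => //.
  by case: s hl {sm sj}.
case: j => // j [sj] hl; rewrite mem_cat; apply/orP; left; apply: map_f.
by apply: IH.
Qed.

Fixpoint profiles (par : seq (nat * nat)) a k : seq (seq (seq bool)) :=
  match par with
  | [::] => if (k == 0%N) && (a == 0%N) then [:: [::]] else [::]
  | (i, c) :: par' =>
      [seq s :: ss | s <- cand c (k + i), ss <-
         if size s == c then
           (if a is a'.+1 then profiles par' a' (count id s) else [::])
         else profiles par' a (count id s)]
  end.

Definition codes m parR parL : seq (seq bool * (seq (seq bool) * seq (seq bool))) :=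
  [seq (s, RL) | s <- bits m, RL <-
    flatten [seq [seq (ssR, ssL) | ssR <- profiles parR a (count id s),
                                   ssL <- profiles parL (3 - a) (count negb s)]
            | a <- iota 0 4]].

Context {R : realType}.

Definition wt n : R := 2^-1 ^+ n.

Lemma wtD m n : wt (m + n) = wt m * wt n. Proof. exact: exprD. Qed.

Lemma wtS n : wt n.+1 = wt n / 2. Proof. exact: exprSr. Qed.

Lemma wt_ge0 n : 0 <= wt n. Proof. by rewrite exprn_ge0// invr_ge0. Qed.

Lemma sum_cand (G : nat -> nat -> R) m j r :
  \sum_(s <- cand m j) wt (size s) * G (m - size s)%N (r + count id s)%N =
  block G m j r.
Proof.
elim: m j r => [|m IH] [|j] r /=; rewrite ?big_nil//.
- by rewrite big_seq1 /= /wt expr0 mul1r addn0.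
- by rewrite big_seq1 /= /wt expr0 mul1r addn0 subn0.
rewrite big_cat !big_map -(IH j r) -(IH j.+1 r.+1) mulrDl !mulr_suml.
congr (_ + _); apply: eq_bigr => s _ /=; rewrite subSS wtS.
  by rewrite add0n mulrAC.
by rewrite add1n addnS addSn mulrAC.
Qed.

Definition wts (ss : seq (seq bool)) : R := wt (sumn (map size ss)).

Lemma sum_profiles par a k : \sum_(ss <- profiles par a k) wts ss = weight par a k.
Proof.
elim: par a k => [|[i c] par IH] a k /=.
  by case: (_ && _); rewrite ?big_seq1 ?big_nil.
rewrite big_allpairs_dep -sum_cand big_seq [RHS]big_seq.
apply: eq_bigr => s /cand_size sc /=; rewrite add0n.
rewrite /wts /=; under eq_bigr do rewrite wtD.
rewrite -mulr_sumr; congr (_ * _).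
have [->|sc'] := eqVneq (size s) c.
  by rewrite subnn; case: (a) => [|a']; rewrite ?big_nil// IH.
case E : (c - size s)%N => [|d]; last exact: IH.
have : (0 < c - size s)%N by rewrite subn_gt0 ltn_neqAle sc'.
by rewrite E.
Qed.

Lemma sum_bits (f : nat -> R) m u :
  \sum_(s <- bits m) wt (size s) * f (u + count id s)%N = bin f m u.
Proof.
elim: m u => [|m IH] u /=; first by rewrite big_seq1 /wt expr0 mul1r addn0.
rewrite big_cat !big_map -(IH u.+1) -(IH u) mulrDl !mulr_suml.
congr (_ + _); apply: eq_bigr => s _ /=; rewrite wtS.
  by rewrite add1n addnS addSn mulrAC.
by rewrite add0n mulrAC.
Qed.

Definition wcode (c : seq bool * (seq (seq bool) * seq (seq bool))) : R :=
  wt (size c.1) * (wts c.2.1 * wts c.2.2).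

Lemma sum_codes m parR parL :
  \sum_(c <- codes m parR parL) wcode c =
  \sum_(a <- iota 0 4)
    bin (fun u => weight parR a u * weight parL (3 - a) (m - u)) m 0.
Proof.
rewrite /codes big_allpairs_dep; under [RHS]eq_bigr do rewrite -sum_bits.
rewrite [RHS]exchange_big big_seq [RHS]big_seq; apply: eq_bigr => s.
rewrite mem_bits => /eqP sm; rewrite big_flatten big_map.
apply: eq_bigr => a _; rewrite big_allpairs_dep add0n /wcode -!sum_profiles.
have -> : (m - count id s = count negb s)%N.
  by rewrite -sm -(count_predC id s) addKn.
rewrite mulr_suml mulr_sumr; apply: eq_bigr => ssR _.
by rewrite -mulr_sumr -mulr_sumr.
Qed.

Lemma ler_sum_inj (I J : eqType) (A : seq I) (B : seq J) (phi : I -> J)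
    (w : J -> R) :
  uniq A -> {in A &, injective phi} -> {in A, forall i, phi i \in B} ->
  (forall y, 0 <= w y) ->
  \sum_(i <- A) w (phi i) <= \sum_(j <- B) w j.
Proof.
move=> uA inj sub w0; rewrite -(big_map phi xpredT w).
have : {subset map phi A <= B} by move=> _ /mapP[i iA ->]; exact: sub.
have : uniq (map phi A) by rewrite map_inj_in_uniq.
elim: (map phi A) B {sub inj uA} => [|j s IH] B /=.
  by rewrite big_nil => _ _; exact: sumr_ge0.
move=> /andP[js us] sB; have jB : j \in B by apply: sB; rewrite mem_head.
rewrite big_cons (perm_big _ (perm_to_rem jB)) big_cons lerD2l.
apply: IH => // i si; have iB : i \in B by apply: sB; rewrite inE si orbT.
apply/negPn/negP => nB; move: iB; rewrite (perm_mem (perm_to_rem jB)) inE.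
by rewrite (negbTE nB) orbF => /eqP ij; move: js; rewrite -ij si.
Qed.

End coding.

(** * The Ray-Knight description as an injection of paths into codes *)

Section encoding.
Implicit Types (p s : seq bool) (a k m j n h : nat) (x y : int).

(** Start and endpoint both lie at or left of [y], so each right step out of [y] is matched by a
    left step out of [y + 1]. *)
Lemma right_profile p h n y : 0 <= endp 0 p <= y ->
  (forall z, z \in rsites y n -> (size (stack 0 p z) <= h)%N) ->
  stack 0 p (y + n%:Z) = [::] ->
  map (stack 0 p) (rsites y n) \in
  profiles (nseq n (0, h)%N)
    (count (fun z => size (stack 0 p z) == h) (rsites y n))
    (count id (stack 0 p y)).
Proof.
elim: n y => [|n IH] y hy hs hn; first by rewrite addr0 in hn; rewrite /= hn.
rewrite /=; apply/allpairsPdep.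
exists (stack 0 p (y + 1)), (map (stack 0 p) (rsites (y + 1) n)); split=> //.
  have bal := stack_balance 0 p y.
  apply: mem_cand.
  - by apply: hs; rewrite mem_head.
  - have E1 : (y < 0) = false by move: hy; clear; lia.
    have E2 : (y < endp 0 p) = false by move: hy; clear; lia.
    by rewrite E1 E2 !addn0 in bal; rewrite addn0.
  - by apply: last_stack_right; move: hy; clear; lia.
have tl : map (stack 0 p) (rsites (y + 1) n) \in profiles (nseq n (0, h)%N)
    (count (fun z => size (stack 0 p z) == h) (rsites (y + 1) n))
    (count id (stack 0 p (y + 1))).
  apply: IH; first by lia.
    by move=> z hz; apply: hs; rewrite inE hz orbT.
  by rewrite -addrA -intS.
by case: eqP => _ /=; rewrite ?add1n ?add0n.
Qed.

(** The path must cross from 0 up to its endpoint, hence one extra right crossing from each site at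
    or above 0; the departure at time 0 raises the cap of the origin. *)
Definition left_par h y : nat * nat := ((0 <= y)%R : nat, if y == 0 then h.+1 else h).

Lemma left_profile p h n y : y <= endp 0 p ->
  (forall z, z \in lsites y n -> (size (stack 0 p z) <= (left_par h z).2)%N) ->
  stack 0 p (y - n%:Z) = [::] ->
  map (fun z => map negb (stack 0 p z)) (lsites y n) \in
  profiles (map (left_par h) (lsites y n))
    (count (fun z => size (stack 0 p z) == (left_par h z).2) (lsites y n))
    (count negb (stack 0 p y)).
Proof.
elim: n y => [|n IH] y hy hs hn; first by rewrite subr0 in hn; rewrite /= hn.
rewrite [lsites _ _]/= ![map _ (_ :: _)]/=; apply/allpairsPdep.
exists (map negb (stack 0 p (y - 1))),
  (map (fun z => map negb (stack 0 p z)) (lsites (y - 1) n)); split=> //.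
  have := stack_balance 0 p (y - 1); rewrite subrK => bal.
  apply: mem_cand.
  - by rewrite size_map; apply: hs; rewrite mem_head.
  - rewrite count_map (eq_count (a2 := id)); last by case.
    move: bal; rewrite (_ : (y - 1 < endp 0 p)%R = true); last by lia.
    by case: ltrP; case: lerP; lia.
  - have := @last_stack_left 0 p (y - 1); rewrite -[false]/(negb true) last_map.
    move=> -> //.
    by lia.
have tl : map (fun z => map negb (stack 0 p z)) (lsites (y - 1) n) \in
  profiles (map (left_par h) (lsites (y - 1) n))
    (count (fun z => size (stack 0 p z) == (left_par h z).2) (lsites (y - 1) n))
    (count negb (stack 0 p (y - 1))).
  apply: IH; first by lia.
    by move=> z hz; apply: hs; rewrite inE hz orbT.
  by rewrite -addrA -opprD -intS.
by rewrite size_map count_map /=; case: eqP => _ /=; rewrite ?add1n ?add0n.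
Qed.

Lemma map_left_par0 h n y : y <= 0 ->
  map (left_par h) (lsites y n) = nseq n (0, h)%N.
Proof.
elim: n y => //= n IH y hy; rewrite IH; last by lia.
rewrite /left_par (_ : (0 <= y - 1)%R = false); last by lia.
by rewrite (_ : (y - 1 == 0) = false)//; lia.
Qed.

Lemma map_left_par h n m :
  map (left_par h) (lsites m.+1%:Z (m.+1 + n)) =
  nseq m (1, h)%N ++ (1, h.+1)%N :: nseq n (0, h)%N.
Proof.
elim: m => [|m IH].
  by rewrite add1n /= subrr map_left_par0.
rewrite addSn [lsites _ _]/= (_ : m.+2%:Z - 1 = m.+1%:Z); last by lia.
by rewrite /= -IH /left_par /= .
Qed.

(** The two windows contain every site other than [x] that a path of length at most [N] can
    reach. *)
Definition good h N (x : nat) p : bool :=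
  [&& (size p <= N)%N, endp 0 p == x, visits 0 p x == h,
      all (fun y => visits 0 p y <= h)%N (rsites x N ++ lsites x (x + N)) &
      (count (fun y => visits 0 p y == h) (rsites x N) +
       count (fun y => visits 0 p y == h) (lsites x (x + N)) == 3)%N].

Definition encode N (x : nat) p :=
  (stack 0 p x, (map (stack 0 p) (rsites x N),
     map (fun y => map negb (stack 0 p y)) (lsites x (x + N)))).

Definition left_pars h (x N : nat) :=
  if x is x'.+1 then nseq x' (1, h)%N ++ (1, h.+1)%N :: nseq N (0, h)%N
  else nseq N (0, h)%N.

Lemma encode_mem h N (x : nat) p : good h N x p ->
  encode N x p \in codes (h - (0 < x)) (nseq N (0, h)%N) (left_pars h x N).
Proof.
move=> /and5P[pN /eqP px /eqP xh /allP hall /eqP three].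
have sz y := size_stack 0 p y; rewrite px in sz.
(* The final visit to [x] has no departure; for [x = 0] the departure at time 0 compensates. *)
have szx : size (stack 0 p x) = (h - (0 < x))%N.
  by have := sz x; rewrite xh eqxx; case: eqP; lia.
apply/allpairsPdep; exists (stack 0 p x), (encode N x p).2; split=> //.
  by rewrite mem_bits szx.
set a := count (fun y => visits 0 p y == h) (rsites x N).
apply/flatten_mapP; exists a; first by rewrite mem_iota; lia.
apply/allpairsPdep; exists (encode N x p).2.1, (encode N x p).2.2; split=> //.
  have szr z : z \in rsites x N -> size (stack 0 p z) = visits 0 p z.
    by rewrite mem_rsites => hz; have := sz z; case: eqP; case: eqP; lia.
  have -> : a = count (fun z => size (stack 0 p z) == h) (rsites x N).
    by apply: eq_in_count => z hz; rewrite szr.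
  apply: right_profile.
  - by rewrite px lexx andbT.
  - by move=> z hz; rewrite szr//; apply: hall; rewrite mem_cat hz.
  - by apply: stack_nil; apply: leq_trans pN _; lia.
have szl z : z \in lsites x (x + N) ->
    size (stack 0 p z) = (visits 0 p z + (z == 0))%N.
  by rewrite mem_lsites => hz; have := sz z; rewrite [0 == z]eq_sym; case: eqP; lia.
have -> : (3 - a)%N = count (fun z => size (stack 0 p z) == (left_par h z).2)
    (lsites x (x + N)).
  rewrite -three addKn; apply: eq_in_count => z hz; rewrite szl// /left_par /=.
  by case: (z == 0); rewrite ?addn0 ?addn1.
have -> : left_pars h x N = map (left_par h) (lsites x (x + N)).
  by case: (x) => [|x']; rewrite ?map_left_par// add0n map_left_par0.
apply: left_profile; first by rewrite px.
  move=> z hz; rewrite szl// /left_par /=.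
  have : (visits 0 p z <= h)%N by apply: hall; rewrite mem_cat hz orbT.
  by case: (z == 0); rewrite ?addn0 ?addn1.
by apply: stack_nil; apply: leq_trans pN _; lia.
Qed.

Lemma all_sites N (x : nat) p y : (size p <= N)%N -> (`|y - 0| < size p)%N ->
  y \in (x : int) :: rsites x N ++ lsites x (x + N).
Proof. by rewrite inE mem_cat mem_rsites mem_lsites; lia. Qed.

Lemma encode_inj h N (x : nat) : {in good h N x &, injective (encode N x)}.
Proof.
move=> p q /and5P[pN _ _ _ _] /and5P[qN _ _ _ _] [Ex Er El].
apply: (@stack_inj 0) => y.
have [yp|yp] := leqP (maxn (size p) (size q)) `|y - 0|.
  by rewrite !stack_nil// (leq_trans _ yp) ?leq_maxl ?leq_maxr.
have : y \in (x : int) :: rsites x N ++ lsites x (x + N).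
  by move: yp; rewrite leq_max => /orP[]; exact: all_sites.
rewrite inE mem_cat => /or3P[/eqP -> //|yr|yl].
  by move/eq_in_map: Er; exact.
by apply: (inj_map negb_inj); move/eq_in_map: El; exact.
Qed.

Lemma wcode_encode (R : realType) h N (x : nat) p : good h N x p ->
  wcode (R := R) (encode N x p) = wt (size p).
Proof.
move=> /and5P[pN _ _ _ _]; rewrite /wcode /wts -!wtD; congr wt.
rewrite -(@sum_size_stack 0 p ((x : int) :: rsites x N ++ lsites x (x + N))).
- rewrite big_cons big_cat /= !sumnE !big_map; congr (_ + (_ + _))%N.
  by apply: eq_bigr => y _; rewrite size_map.
- exact: uniq_sites.
- by move=> y; exact: all_sites.
Qed.

(** [encode] is injective and preserves weights, since every step of the path lies in exactly one
    stack. *)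
Lemma good_sum_le (R : realType) h N (x : nat) (A : seq (seq bool)) : uniq A ->
  {in A, forall p, good h N x p} ->
  \sum_(p <- A) wt (R := R) (size p) <=
  \sum_(a <- iota 0 4) bin (fun u => weight (nseq N (0, h)%N) a u *
    weight (left_pars h x N) (3 - a) (h - (0 < x) - u)) (h - (0 < x)) 0.
Proof.
move=> uA gA; rewrite -sum_codes big_seq.
under eq_bigr => p pA do rewrite -(@wcode_encode R h N x p (gA p pA)).
rewrite -big_seq; apply: ler_sum_inj => //.
- by move=> p q pA qA; apply: encode_inj; exact: gA.
- by move=> p pA; apply: encode_mem; exact: gA.
- by move=> c; rewrite /wcode !mulr_ge0 ?wt_ge0.
Qed.

End encoding.

(** * Summation over levels *)

Section level_sums.
Context {R : realType}.
Implicit Types (h N : nat).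

Definition level_weight h N : R :=
  \sum_(x < N.+1) \sum_(a <- iota 0 4)
    bin (fun u => weight (nseq N (0, h)%N) a u *
      weight (left_pars h x N) (3 - a) (h - (0 < x)%N - u)) (h - (0 < x)%N) 0.

Lemma level_weightE h N : level_weight h N =
  \sum_(a <- iota 0 4)
   (bin (fun u => weight (nseq N (0, h)%N) a u *
           weight (nseq N (0, h)%N) (3 - a) (h - u)) h 0 +
    bin (fun u => weight (nseq N (0, h)%N) a u *
           left_sum h N N (3 - a) (h.-1 - u)) h.-1 0).
Proof.
rewrite /level_weight exchange_big; apply: eq_bigr => a _.
rewrite big_ord_recl; congr (_ + _); first by rewrite /= subn0.
rewrite /left_sum -subn1.
have bin_sum (I : Type) (s : seq I) (F : I -> nat -> R) m u :
    bin (fun v => \sum_(i <- s) F i v) m u = \sum_(i <- s) bin (F i) m u.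
  elim: m u => [|m IH] u //=; rewrite !IH -big_split mulr_suml.
  by apply: eq_bigr.
transitivity (\sum_(x < N) bin (fun u => weight (nseq N (0, h)%N) a u *
    left_weight h N x (3 - a) (h - 1 - u)) (h - 1) 0 : R); first exact: eq_bigr.
rewrite -bin_sum; congr (bin _ _ _); apply/funext => u.
by rewrite mulr_sumr.
Qed.

(** Serves the finitely many small levels; what matters is uniformity in [N]. *)
Lemma level_weight_crude h N : level_weight h N <= 4 * (2 * h%:R + 3).
Proof.
rewrite level_weightE -[4]/(4%:R) mulr_natl -[in leRHS](card_ord 4) -sumr_const.
rewrite -[iota 0 4]val_enum_ord big_map big_enum /=; apply: ler_sum => a _.
apply: (@le_trans _ _ (bin (fun _ => 1) h 0 + bin (fun _ => 2 * h%:R + 2) h.-1 0)).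
  apply: lerD; apply: bin_le => u _.
    by rewrite mulr_ile1 ?weight_ge0 ?weight_le1.
  apply: (@le_trans _ _ (1 * left_sum h N N (3 - a) (h.-1 - u))).
    by rewrite ler_wpM2r ?left_sum_ge0 ?weight_le1.
  rewrite mul1r; apply: le_trans (left_sum_crude h N N _ _ _) _.
    by rewrite (leq_trans (leq_subr _ _))// leq_pred.
  by rewrite lerBlDr lerDl.
by rewrite !bin_const; lra.
Qed.

Lemma level_weight_le h N (e : R) : 0 < e -> e <= 3^-1 -> 1 <= e * h%:R ->
  1200 * h%:R ^+ 2 * tail_base e ^+ h <= e ^+ 5 ->
  level_weight h N <= 4000 * (e ^+ 5 * h%:R).
Proof.
move=> e0 e3 eh dl; rewrite level_weightE.
apply: (@le_trans _ _ (\sum_(a <- iota 0 4) (921 * (e ^+ 5 * h%:R)))).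
  rewrite big_seq [leRHS]big_seq; apply: ler_sum => a; rewrite mem_iota => /andP[_ a4].
  have a3 : (a + (3 - a) = 3)%N by rewrite subnKC.
  have := @profile_pos_le R e h e0 e3 eh dl N N N a (3 - a) a3.
  have := @profile0_le R e h e0 e3 eh dl N N a (3 - a) a3.
  by lra.
have : 0 <= e ^+ 5 * h%:R by rewrite mulr_ge0// exprn_ge0// ltW.
by rewrite /= !big_cons big_nil; lra.
Qed.

(* Levels are estimated with [e = h ^ (-9/20)], for which [e ^ 5 * h = h ^ (-5/4)]
   is summable while [tail_base e ^ h] decays faster than any power of [h]. *)
Definition root20 h : R := expR (ln h%:R / 20).

Lemma root20X h : (0 < h)%N -> root20 h ^+ 20 = h%:R.
Proof.
by move=> h0; rewrite /root20 -expRM_natr divfK// lnK// posrE ltr0n.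
Qed.

Lemma expR_sqr_ge_pow n : exists2 c : R, 0 < c &
  forall x, 0 <= x -> c * x ^+ (2 * n.+1) <= expR (x ^+ 2 / 4).
Proof.
exists (4 ^+ n.+1 * n.+1`!%:R)^-1.
  by rewrite invr_gt0 mulr_gt0 ?exprn_gt0// ltr0n fact_gt0.
move=> x x0; have t0 : 0 <= x ^+ 2 / 4 by rewrite divr_ge0// exprn_ge0.
apply: le_trans (expR_ge1Dxn n t0); rewrite expr_div_n -exprM invfM.
by rewrite mulrC mulrA -[leLHS]add0r lerD2r.
Qed.

Lemma level_weight_decay : exists h0, forall h N, (h0 < h)%N ->
  level_weight h N <= 4000 * (root20 h ^+ 25)^-1.
Proof.
(* The power obtained is 86 = 40 + 45 + 1: [h ^+ 2] is [y ^+ 40], the inverse of [e ^+ 5] is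
   [y ^+ 45], and one more [y] absorbs [1200 / c]. *)
have [c c0 hc] := expR_sqr_ge_pow 42.
pose Y : R := 3 + 1200 / c.
have Y3 : 3 <= Y.
  by rewrite /Y lerDl; exact: divr_ge0 (ler0n _ _) (ltW c0).
have Y0 : 0 <= Y := le_trans (ler0n _ 3) Y3.
have [h0 hh0] : exists h0 : nat, Y ^+ 20 <= h0%:R.
  by exists (Num.bound (Y ^+ 20)); exact: ltW (archi_boundP (exprn_ge0 20 Y0)).
exists h0 => h N h0h; have h_gt0 : (0 < h)%N := leq_ltn_trans (leq0n _) h0h.
set y := root20 h; have yX : y ^+ 20 = h%:R := root20X h h_gt0.
have y0 : 0 < y := expR_gt0 _.
have Yy : Y <= y.
  rewrite -(@ler_pXn2r _ 20) ?nnegrE ?(ltW y0)//.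
  by rewrite yX (le_trans hh0)// ler_nat ltnW.
have y3 : 3 <= y := le_trans Y3 Yy.
have y1 : 1 <= y by apply: le_trans y3; rewrite ler1n.
pose e := (y ^+ 9)^-1.
have e0 : 0 < e by rewrite invr_gt0 exprn_gt0.
have ey : e * y ^+ 9 = 1 by rewrite mulVf// expf_neq0// gt_eqF.
have eh : e * h%:R = y ^+ 11 by rewrite -yX (exprD y 9 11) mulrA ey mul1r.
have e3 : e <= 3^-1.
  rewrite lef_pV2 ?posrE ?exprn_gt0//.
  by apply: le_trans y3 _; rewrite exprS ler_peMr ?exprn_ege1// ltW.
have e2h : e ^+ 2 * h%:R = y ^+ 2.
  by rewrite expr2 -mulrA eh (exprD y 9 2) mulrA ey mul1r.
have yn0 n : y ^+ n != 0 by rewrite expf_neq0// gt_eqF.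
have e5 : e ^+ 5 = (y ^+ 45)^-1 by rewrite /e exprVn -exprM.
have e5h : e ^+ 5 * h%:R = (y ^+ 25)^-1.
  by rewrite e5 -yX -[in LHS](subnKC (isT : (25 <= 45)%N)) exprD invfM mulfVK.
rewrite -e5h; apply: level_weight_le => //.
  by rewrite eh exprn_ege1.
have q_le : tail_base e ^+ h <= expR (- (y ^+ 2 / 4)).
  apply: (@le_trans _ _ (expR (- (e ^+ 2 / 4)) ^+ h)).
    apply: lerXn2r (tail_base_le e e0 e3); rewrite ?nnegrE ?expR_ge0//.
    by rewrite -[tail_base e]expr1 tail_baseX_ge0.
  rewrite -expRM_natr ler_expR.
  by rewrite mulNr mulrAC e2h.
have exp_big := hc y (ltW y0).
have h2 : h%:R ^+ 2 = y ^+ 40 by rewrite -yX -exprM.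
rewrite h2 e5.
apply: (@le_trans _ _ (1200 * y ^+ 40 * expR (- (y ^+ 2 / 4)))).
  have p0 : 0 <= 1200 * y ^+ 40 := mulr_ge0 (ler0n _ _) (exprn_ge0 _ (ltW y0)).
  exact: (ler_wpM2l p0 q_le).
have y45 : 0 < y ^+ 45 := exprn_gt0 45 y0.
rewrite expRN (ler_pdivrMr _ _ (expR_gt0 _)) (ler_pdivlMl _ _ y45).
apply: le_trans exp_big; rewrite mulrCA -exprD.
rewrite [y ^+ (2 * 43)](exprS y 85) mulrA.
apply: (ler_wpM2r (exprn_ge0 _ (ltW y0))).
rewrite -(ler_pdivrMl _ _ c0) mulrC; apply: le_trans Yy.
by rewrite /Y lerDr.
Qed.


(** Compares the power -5/4 of [h.+1] with the increment of the power -1/4; the logarithm grows by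
    at least the inverse of [h.+1]. *)
Lemma telescoping_bound h : (0 < h)%N ->
  (root20 h.+1 ^+ 25)^-1 <=
  4 * (expR (- (ln h%:R / 4)) - expR (- (ln h.+1%:R / 4))) :> R.
Proof.
move=> h0; rewrite /root20.
have : expR (ln h%:R) = h%:R :> R by rewrite lnK// posrE ltr0n.
have : expR (ln h.+1%:R) = h.+1%:R :> R by rewrite lnK// posrE ltr0n.
move: (ln h%:R) (ln h.+1%:R) => A B eB eA.
have AB : expR (- B) <= B - A.
  have := expR_ge1Dx (A - B); rewrite expRD eA expRN eB.
  have -> : h%:R = h.+1%:R - 1 :> R by rewrite -natr1 addrK.
  by rewrite mulrBl divff ?pnatr_eq0// mul1r; move: (_^-1) => t; lra.
have -> : (expR (B / 20) ^+ 25)^-1 = expR (- (B / 4)) * expR (- B).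
  by rewrite -expRM_natr -expRN -expRD; congr expR; field.
have -> : expR (- (A / 4)) = expR (- (B / 4)) * expR ((B - A) / 4).
  by rewrite -expRD; congr expR; field.
have E1 := expR_ge1Dx ((B - A) / 4).
have : 0 <= expR (- (B / 4)) * (4 * (expR ((B - A) / 4) - 1) - expR (- B)).
  by rewrite mulr_ge0 ?expR_ge0//; lra.
lra.
Qed.

Lemma sum_decay n : \sum_(h < n) (root20 h.+1 ^+ 25)^-1 <= 5.
Proof.
suff H m : \sum_(h < m.+1) (root20 h.+1 ^+ 25)^-1 <=
    5 - 4 * expR (- (ln m.+1%:R / 4)).
  case: n => [|n]; first by rewrite big_ord0.
  by apply: le_trans (H n) _; rewrite gerBl mulr_ge0// expR_ge0.
elim: m => [|m IH].
  rewrite big_ord_recl big_ord0 addr0 /= /root20 ln1 !mul0r oppr0 expR0 expr1n invr1.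
  by lra.
rewrite big_ord_recr /=; have := @telescoping_bound m.+1 isT; lra.
Qed.

Lemma level_weight_summable : exists C, forall n N,
  \sum_(h < n) level_weight h.+1 N <= C.
Proof.
have [h0 hh0] := level_weight_decay.
pose K : R := 4 * (2 * h0%:R + 3).
have K0 : 0 <= K by rewrite /K; have : 0 <= h0%:R :> R by []; lra.
exists (K * h0%:R + 4000 * 5) => n N.
apply: (@le_trans _ _ (\sum_(h < n) (K * (h < h0)%N%:R +
    4000 * (root20 h.+1 ^+ 25)^-1))).
  apply: ler_sum => h _; have y1 : 0 <= (root20 h.+1 ^+ 25)^-1.
    by rewrite invr_ge0 exprn_ge0 ?expR_ge0.
  have y0 : 0 <= 4000 * (root20 h.+1 ^+ 25)^-1 := mulr_ge0 (ler0n _ _) y1.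
  case: ltnP => hh; last by rewrite mulr0 add0r; exact: hh0.
  rewrite mulr1; apply: (@le_trans _ _ K); last by rewrite lerDl.
  apply: le_trans (level_weight_crude _ _) _; rewrite /K.
  by have : h.+1%:R <= h0%:R :> R by [rewrite ler_nat]; lra.
rewrite big_split -!mulr_sumr /=; apply: lerD.
  rewrite ler_wpM2l// -natr_sum ler_nat.
  elim: n => [|n IH]; first by rewrite big_ord0.
  rewrite big_ord_recr /=; case: ltnP => hn; last by rewrite addn0.
  rewrite addn1; apply: leq_trans hn; rewrite ltnS.
  apply: (@leq_trans (\sum_(i < n) 1)); last by rewrite sum1_card card_ord.
  by apply: leq_sum => i _; exact: leq_b1.
exact: (ler_wpM2l (ler0n _ _) (sum_decay n)).
Qed.

Fixpoint paths_upto M : seq (seq bool) :=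
  if M is M'.+1 then paths_upto M' ++ bits M else bits 0.

Lemma paths_uptoS M : paths_upto M.+1 = paths_upto M ++ bits M.+1.
Proof. by []. Qed.

Lemma paths_upto_size M p : p \in paths_upto M -> (size p <= M)%N.
Proof.
elim: M => [|M IH]; first by rewrite -[paths_upto 0]/(bits 0) mem_bits => /eqP ->.
by rewrite paths_uptoS mem_cat mem_bits => /orP[/IH/leqW //|/eqP ->].
Qed.

Lemma uniq_paths_upto M : uniq (paths_upto M).
Proof.
elim: M => [|M IH] //; rewrite paths_uptoS cat_uniq IH uniq_bits andbT andTb.
apply/hasPn => p; rewrite mem_bits => /eqP pM; apply/negP => /paths_upto_size.
by rewrite pM ltnn.
Qed.

(** Each path is charged to its level and endpoint. Reflection preserves weights and handles
    negative endpoints, whence the factor 2. *)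
Lemma good_paths_sum M (fav : pred (seq bool)) :
  (forall p, fav p -> (size p <= M)%N -> exists h x, [/\ (h < M)%N, (x <= M)%N &
     good h.+1 M x p || good h.+1 M x (map negb p)]) ->
  \sum_(p <- paths_upto M | fav p) wt (size p) <=
  2 * \sum_(h < M) level_weight h.+1 M.
Proof.
move=> hfav.
pose f (q : seq bool -> seq bool) (h x : nat) : R :=
  \sum_(p <- paths_upto M) (good h.+1 M x (q p))%:R * wt (size (q p)).
have f_le q (h x : nat) : injective q -> f q h x <=
    \sum_(a <- iota 0 4) bin (fun u => weight (nseq M (0, h.+1)%N) a u *
      weight (left_pars h.+1 x M) (3 - a) (h.+1 - (0 < x)%N - u))
        (h.+1 - (0 < x)%N) 0.
  move=> qi; rewrite /f.
  rewrite -(big_map q xpredT (fun p => (good h.+1 M x p)%:R * wt (size p))).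
  rewrite (eq_bigr (fun p => if good h.+1 M x p then wt (size p) else 0)).
    rewrite -big_mkcond -big_filter; apply: good_sum_le => //.
      by rewrite filter_uniq// map_inj_uniq// uniq_paths_upto.
    by move=> p; rewrite mem_filter => /andP[].
  by move=> p _; case: good; rewrite ?mul1r ?mul0r.
have E : \sum_(p <- paths_upto M | fav p) wt (size p) <=
    \sum_(h < M) \sum_(x < M.+1) (f id h x + f (map negb) h x).
  rewrite /f; under [leRHS]eq_bigr => h _ do under eq_bigr => x _ do
    rewrite -big_split.
  under [leRHS]eq_bigr => h _ do rewrite exchange_big.
  rewrite exchange_big big_mkcond big_seq [leRHS]big_seq.
  apply: ler_sum => p /paths_upto_size pM.
  have t0 (h x : nat) : 0 <= (good h.+1 M x (id p))%:R * wt (size (id p)) +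
      (good h.+1 M x (map negb p))%:R * wt (size (map negb p)) :> R.
    by rewrite addr_ge0 ?mulr_ge0 ?wt_ge0.
  case: ifP => [/hfav/(_ pM)[h [x [hM xM hg]]]|_]; last first.
    by apply: sumr_ge0 => h _; apply: sumr_ge0 => x _; exact: t0.
  rewrite (bigD1 (Ordinal hM))//= (bigD1 (Ordinal (xM : (x < M.+1)%N)))//=.
  rewrite -addrA; apply: ler_wpDr.
    apply: addr_ge0; apply: sumr_ge0 => i _; first exact: t0.
    by apply: sumr_ge0 => j _; exact: t0.
  rewrite size_map -mulrDl ler_peMl ?wt_ge0//.
  by case/orP: hg => ->; rewrite ?lerDl ?lerDr.
apply: le_trans E _; rewrite mulr_sumr; apply: ler_sum => h _.
rewrite /level_weight mulr_sumr; apply: ler_sum => x _.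
rewrite mulrDl mul1r; apply: lerD; apply: f_le => //.
exact: inj_map negb_inj.
Qed.

End level_sums.

(** * Favourite sites of a finite path *)

Section favourite_paths.
Implicit Types (p : seq bool) (x y z : int).

(** A path viewed as a walk on a one-point space, so that the definitions for walks apply to it. *)
Definition path_walk p (n : nat) (_ : unit) : int := endp 0 (take n p).

Definition favourite_path p : bool :=
  `[< favourite_times (path_walk p) 4 tt (size p) >].

Lemma card_visits z p y :
  #|[set s : 'I_(size p).+1 | (0 < s)%N && (endp z (take s p) == y)]%SET| =
  visits z p y.
Proof.
rewrite -sum1dep_card big_mkcond big_ord_recl /= add0n.
elim: p z => [|b p IH] z; first by rewrite big_ord0.
rewrite big_ord_recl /= take0 /=; congr (_ + _)%N.
by rewrite -(IH (step z b)); apply: eq_bigr.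
Qed.

Lemma visits_endp z p : p != [::] -> (0 < visits z p (endp z p))%N.
Proof.
elim: p z => // b [|c p] IH z _; first by rewrite /= eqxx.
by have := IH (step z b) isT; rewrite /=; lia.
Qed.

Lemma visits_le_size z p y : (visits z p y <= size p)%N.
Proof. by elim: p z => //= b p IH z; have := IH (step z b); case: eqP; lia. Qed.

Lemma visits_far z p y : (size p < `|y - z|)%N -> visits z p y = 0%N.
Proof.
elim: p z => //= b p IH z hy; rewrite IH; last by rewrite /step; case: b; lia.
by rewrite addn0; case: eqP => //; rewrite /step; case: b; lia.
Qed.

Lemma endp_near z p : (`|endp z p - z| <= size p)%N.
Proof.
elim: p z => [|b p IH] z /=; first by lia.
by have := IH (step z b); rewrite /step; case: b; lia.
Qed.

Lemma endp_negb z p : endp (- z) (map negb p) = - endp z p.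
Proof.
elim: p z => //= b p IH z; rewrite -IH; congr endp.
by rewrite /step; case: b => /=; lia.
Qed.

Lemma visits_negb z p y : visits (- z) (map negb p) y = visits z p (- y).
Proof.
elim: p z => //= b p IH z; have -> : step (- z) (~~ b) = - step z b.
  by rewrite /step; case: b => /=; lia.
by rewrite IH eqr_oppLR.
Qed.

Lemma good_of_favourites M p (s : seq int) : 0 <= endp 0 p ->
  p != [::] -> (size p <= M)%N -> uniq s -> size s = 4 ->
  (forall y, (visits 0 p y <= visits 0 p (endp 0 p))%N) ->
  (forall y, (y \in s) = (visits 0 p y == visits 0 p (endp 0 p))) ->
  good (visits 0 p (endp 0 p)) M `|endp 0 p|%N p.
Proof.
move=> e0 p0 pM us s4 hmax hs.
have xE : (`|endp 0 p|%N : int) = endp 0 p by lia.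
have v0 := visits_endp 0 p p0.
apply/and5P; split; rewrite ?xE//; first by apply/allP => y _.
have /perm_size : perm_eq s ([seq y <- endp 0 p :: rsites (endp 0 p) M ++
    lsites (endp 0 p) (`|endp 0 p| + M) | visits 0 p y == visits 0 p (endp 0 p)]).
  apply: uniq_perm => // [|y]; first by rewrite filter_uniq// uniq_sites.
  rewrite mem_filter hs; case: eqP => //= yv; symmetry.
  have yp : (`|y - 0| <= size p)%N.
    by rewrite leqNgt; apply/negP => /visits_far yv0; move: v0; rewrite -yv yv0.
  rewrite inE mem_cat mem_rsites mem_lsites.
  by move: yp pM e0; clear; lia.
rewrite s4 size_filter /= eqxx count_cat => E.
by apply/eqP; apply: succn_inj; exact: esym E.
Qed.

Lemma favourite_path_good M p : favourite_path p -> (size p <= M)%N ->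
  exists h (x : nat), [/\ (h < M)%N, (x <= M)%N &
    good h.+1 M x p || good h.+1 M x (map negb p)].
Proof.
move=> /asboolP[p1 fx fcard] pM.
have lt y : local_time (path_walk p) tt (size p) y = visits 0 p y.
  exact: card_visits.
have endE : path_walk p (size p) tt = endp 0 p by rewrite /path_walk take_size.
rewrite endE in fx.
have p0 : p != [::] by case: (p) p1.
have v0 := visits_endp 0 p p0.
have hmax y : (visits 0 p y <= visits 0 p (endp 0 p))%N by rewrite -!lt; exact: fx.
have [fK fK4] : finite_set (favourite_sites (path_walk p) tt (size p)) /\
    #|` fset_set (favourite_sites (path_walk p) tt (size p))| = 4%N.
  have fK : finite_set (favourite_sites (path_walk p) tt (size p)).
    by exists 4%N.
  split=> //; apply/card_fset_set => //.
pose s : seq int := fset_set (favourite_sites (path_walk p) tt (size p)).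
have us : uniq s by exact: fset_uniq.
have hs y : (y \in s) = (visits 0 p y == visits 0 p (endp 0 p)).
  rewrite in_fset_set//; apply/idP/eqP => [/set_mem fy|yv].
    by apply/eqP; rewrite eqn_leq hmax -!lt fy.
  by apply/mem_set => z; rewrite !lt yv.
have vM : (visits 0 p (endp 0 p) <= M)%N := leq_trans (visits_le_size _ _ _) pM.
exists (visits 0 p (endp 0 p)).-1, `|endp 0 p|%N; rewrite prednK//; split=> //.
  by have := endp_near 0 p; rewrite subr0 => /leq_trans; exact.
have [e0|e0] := leP 0 (endp 0 p).
  by rewrite (@good_of_favourites M p s).
apply/orP; right.
have eN : endp 0 (map negb p) = - endp 0 p by rewrite -{1}oppr0 endp_negb.
have vN y : visits 0 (map negb p) y = visits 0 p (- y).
  by rewrite -{1}oppr0 visits_negb.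
have := @good_of_favourites M (map negb p) (map -%R s).
rewrite eN vN opprK abszN size_map; apply => //.
- by rewrite oppr_ge0 ltW.
- by case: (p) p0.
- by rewrite map_inj_uniq//; exact: oppr_inj.
- by rewrite size_map.
- by move=> y; rewrite vN.
- by move=> y; rewrite vN -hs -[y in LHS]opprK mem_map//; exact: oppr_inj.
Qed.

End favourite_paths.

(** * From the random walk to weighted paths *)

Section walk_events.
Context {R : realType} {d : measure_display} {T : measurableType d}.
Context (P : probability T R) (S : nat -> {RV P >-> int}).
Implicit Types (p : seq bool) (t : nat).

(** A nonnegative integral is a supremum over simple functions below the integrand, and a larger
    integrand only enlarges that family. *)
Lemma ge0_le_integral_nomeas (f g : T -> \bar R) : (forall w, 0 <= f w)%E ->
  (forall w, f w <= g w)%E -> (\int[P]_w f w <= \int[P]_w g w)%E.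
Proof.
move=> f0 fg; have g0 w : (0 <= g w)%E := le_trans (f0 w) (fg w).
rewrite !ge0_integralTE//; apply: le_ereal_sup => _ [h hf <-].
by exists h => // w; exact: le_trans (hf w) (fg w).
Qed.

Lemma measurable_increment t (A : set int) :
  measurable [set w | A (increment S t w)].
Proof.
have -> : [set w | A (increment S t w)] =
    \bigcup_(k : int) ([set w | S t w = k] `&` [set w | A (S t.+1 w - k)]).
  apply/seteqP; split=> [w Aw|w [k _ [<-]]] //.
  by exists (S t w).
apply: countable_bigcupT_measurable; first exact: countableP.
move=> k; apply: measurableI.
  rewrite -[X in measurable X]setTI.
  exact: (measurable_funP (S t) measurableT [set k] I).
rewrite -[X in measurable X]setTI.
exact: (measurable_funP (S t.+1) measurableT [set z | A (z - k)] I).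
Qed.

Definition path_event p : set T :=
  \bigcap_(i in [set` fset_set `I_(size p)])
    (increment S i @^-1` [set (if nth false p i then 1 else -1)]).

(** The increments are plus or minus one only almost surely; this null event collects the
    exceptions. *)
Definition bad_event : set T :=
  \bigcup_t [set w | increment S t w != 1 /\ increment S t w != -1].

Lemma measurable_path_event p : measurable (path_event p).
Proof.
apply: fin_bigcap_measurable => [|i _]; first exact: finite_fset.
exact: measurable_increment.
Qed.

Lemma measurable_bad_event : measurable bad_event.
Proof.
apply: bigcupT_measurable => t.
exact: (measurable_increment t [set z | z != 1 /\ z != -1]).
Qed.

Context (S_walk : simple_symmetric_walk S).

Lemma path_event_prob p : P (path_event p) = (wt (size p))%:E.
Proof.
rewrite /path_event (increment_independent S_walk)//.
rewrite (eq_bigr (fun _ => (2^-1 : R)%:E)).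
  rewrite prodEFin; congr EFin.
  rewrite big_const_seq count_predT.
  have -> : size (fset_set `I_(size p)) = size p by exact/card_fset_set/card_eqxx.
  by rewrite /wt; elim: (size p) => //= n ->; rewrite exprS.
move=> i _; case: nth; first exact: (increment_up S_walk).
exact: (increment_down S_walk).
Qed.

Lemma bad_event_prob : P bad_event = 0%E.
Proof.
have neg : P.-negligible bad_event.
  apply: negligible_bigcup => t; apply/negligibleP.
    exact: (measurable_increment t [set z | z != 1 /\ z != -1]).
  have -> : [set w | increment S t w != 1 /\ increment S t w != -1] =
      ~` ([set w | increment S t w = 1] `|` [set w | increment S t w = -1]).
    apply/seteqP; split=> w /=; first by move=> [/eqP h1 /eqP h2] [].
    by move=> /not_orP[/eqP ? /eqP ?].
  suff : P (~` ([set w | increment S t w = 1] `|`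
      [set w | increment S t w = -1])) = 0%E by [].
  have mup := measurable_increment t [set 1].
  have mdown := measurable_increment t [set -1].
  rewrite probability_setC; last exact: measurableU.
  have -> : P ([set w | increment S t w = 1] `|` [set w | increment S t w = -1]) =
      adde (P [set w | increment S t w = 1]) (P [set w | increment S t w = -1]).
    by apply: measureU => //; apply/seteqP; split=> w //= [->].
  rewrite (increment_up S_walk) (increment_down S_walk) -EFinD.
  have -> : 2^-1 + 2^-1 = 1 :> R by field.
  by rewrite subrr.
by apply/negligibleP => //; exact: measurable_bad_event.
Qed.

(** A measurable set containing the event that [t] is a favourite time. *)
Definition favourite_event t : set T :=
  \big[setU/set0]_(p <- bits t | favourite_path p) path_event p `|` bad_event.

Lemma measurable_favourite_event t : measurable (favourite_event t).
Proof.
apply: measurableU; last exact: measurable_bad_event.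
by apply: bigsetU_measurable => p _; exact: measurable_path_event.
Qed.

Lemma favourite_event_prob t :
  (P (favourite_event t) <=
   (\sum_(p <- bits t | favourite_path p) wt (size p))%:E)%E.
Proof.
apply: le_trans (measureU2 _ _ _) _.
- by apply: bigsetU_measurable => p _; exact: measurable_path_event.
- exact: measurable_bad_event.
rewrite [X in (_ + X)%E]bad_event_prob adde0.
elim: (bits t) => [|p s IH]; first by rewrite !big_nil measure0.
rewrite !big_cons; case: ifP => // _.
apply: le_trans (measureU2 _ _ _) _.
- exact: measurable_path_event.
- by apply: bigsetU_measurable => q _; exact: measurable_path_event.
by rewrite EFinD -path_event_prob; apply: leeD.
Qed.

Context (S_start : forall w : T, S 0%N w = 0).

Lemma favourite_times_event t w : favourite_times S 4 w t -> favourite_event t w.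
Proof.
move=> ft; have [wbad|wbad] := pselect (bad_event w); [by right|left].
have pm i : increment S i w = if increment S i w == 1 then 1 else -1.
  case: eqP => [//|/eqP h1]; apply/eqP/negPn/negP => h2.
  by apply: wbad; exists i.
pose p := mkseq (fun i => increment S i w == 1) t.
have sp : size p = t by rewrite size_mkseq.
have wp : path_event p w.
  move=> i /=; rewrite in_fset_set ?sp// => /set_mem it.
  by rewrite pm nth_mkseq.
have walkE s : (s <= t)%N -> S s w = endp 0 (take s p).
  have endp_rcons z q b : endp z (rcons q b) = step (endp z q) b.
    by elim: q z => //= c q IH z; rewrite IH.
  elim: s => [|s IH] st; first by rewrite take0 S_start.
  rewrite (take_nth false) ?sp// endp_rcons -IH ?(ltnW st)// nth_mkseq//.
  have -> : S s.+1 w = S s w + increment S s w by rewrite /increment addrC subrK.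
  by rewrite pm /step; case: eqP.
have lt y : local_time (path_walk p) tt t y = local_time S w t y.
  by apply: eq_card => s; rewrite !inE /path_walk walkE// -ltnS.
have favE : favourite_sites (path_walk p) tt t = favourite_sites S w t.
  by apply/seteqP; split=> y hy z; have := hy z; rewrite !lt.
rewrite -bigcup_seq_cond; exists p => //=; apply/andP; split.
  by rewrite mem_bits sp.
apply/asboolP; rewrite /favourite_times /= sp favE.
have -> : path_walk p t tt = S t w by rewrite walkE.
exact: ft.
Qed.

Lemma integral_favourite_count_le (C : R) :
  (forall M, \sum_(p <- paths_upto M | favourite_path p) wt (size p) <= C) ->
  (\int[P]_w favourite_count R S 4 w <= C%:E)%E.
Proof.
move=> hC.
apply: (@le_trans _ _ (\int[P]_w \sum_(t <oo) (\1_(favourite_event t) w)%:E)%E).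
  apply: ge0_le_integral_nomeas => w; first exact: measure_ge0.
  rewrite /favourite_count counting_dirac; apply: lee_nneseries => t _ //.
  rewrite /dirac !indicE lee_fin ler_nat.
  case: (boolP (_ \in favourite_times _ _ _)) => //= /set_mem ft.
  by rewrite mem_set//; exact: favourite_times_event.
(* Tonelli exchanges sum and integral; it then suffices to bound the partial sums, whose terms are
   total weights of favourite paths of given length. *)
rewrite integral_nneseries//; last first.
  by move=> t; apply/measurable_EFinP; exact/measurable_indic/measurable_favourite_event.
apply: lime_le; first by apply: is_cvg_nneseries => t _ _; exact: integral_ge0.
apply: nearW => n; apply: (@le_trans _ _
  (\sum_(p <- paths_upto n | favourite_path p) wt (size p))%:E);
  last by rewrite lee_fin.
have le1 t : (\int[P]_w (\1_(favourite_event t) w)%:E <=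
    (\sum_(p <- bits t | favourite_path p) wt (size p))%:E)%E.
  rewrite integral_indic// ?setIT; first exact: favourite_event_prob.
  exact: measurable_favourite_event.
apply: (@le_trans _ _ (\sum_(0 <= t < n.+1)
  (\sum_(p <- bits t | favourite_path p) wt (size p))%:E)%E).
  rewrite big_nat_recr//= -[leLHS]adde0; apply: leeD; first exact: lee_sum.
  by rewrite lee_fin sumr_ge0// => p _; exact: wt_ge0.
rewrite sumEFin lee_fin; elim: n => [|n IH]; first by rewrite big_nat1.
by rewrite paths_uptoS [leRHS]big_cat big_nat_recr//; exact: lerD.
Qed.

End walk_events.

Theorem theorem1 (R : realType) (d : measure_display) (T : measurableType d)
    (P : probability T R) (S : nat -> {RV P >-> int})
    (S_walk : simple_symmetric_walk S) (S_start : forall w : T, S 0%N w = 0) :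
  (\int[P]_w favourite_count R S 4 w < +oo)%E.
Proof.
have [C hC] := @level_weight_summable R.
apply: (@le_lt_trans _ _ (2 * C)%:E); last exact: ltry.
apply: integral_favourite_count_le => // M.
apply: le_trans (good_paths_sum _ _ _) _; last by rewrite ler_pM2l.
by move=> p fp pM; exact: favourite_path_good.
Qed.
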